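(* Let $n\geq 1$ and let $\tilde x_1,\tilde x_2,\tilde x_3,\tilde x_4\in\mathbb{C}[s,t,u]$ be homogeneous polynomials of degree $n$. Suppose that the surface $\left(\frac{\tilde x_1}{\tilde x_4},\frac{\tilde x_2}{\tilde x_4},\frac{\tilde x_3}{\tilde x_4}\right)$ has no base points, and that there are exactly $n$ linearly independent moving planes of degree $n-1$ following the surface (i.e. the space of such moving planes has dimension $n$). Then the method of moving quadrics applies and computes a power of the implicit equation of the surface: if $F\in\mathbb{C}[X_1,X_2,X_3,X_4]$ denotes the irreducible homogeneous polynomial defining the surface, the determinant produced by the method equals $\lambda F^k$ for some $\lambda\in\mathbb{C}\setminus\{0\}$ and some integer $k\ge1$.
   Context: No base points means that $\tilde x_1,\dots,\tilde x_4$ have no common zero in $\mathbb{P}^2_{\mathbb{C}}$. The implicit equation $F=0$ is the equation of the smallest algebraic surface in $\mathbb{P}^3_{\mathbb{C}}$ containing the image of the parametrization $(\tilde x_1:\tilde x_2:\tilde x_3:\tilde x_4)$. The parametrization is not assumed to be generically one-to-one. A moving $d$-surface of degree $\sigma$ is an expression $\sum_{i+j\le\sigma}\bigl(\sum_{|\gamma|=d}A^{ij}_\gamma X^\gamma\bigr)s^it^ju^{\sigma-i-j}$ with $A^{ij}_\gamma\in\mathbb{C}$, $\gamma\in\mathbb{Z}_{\ge0}^4$, $X^\gamma=X_1^{\gamma_1}\cdots X_4^{\gamma_4}$. It follows the rational surface if it becomes identically zero as a polynomial in $s,t,u$ after substituting $X_a=\tilde x_a(s,t,u)$, $a=1,\dots,4$.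 For $d=1$ it is called a moving plane, for $d=2$ a moving quadric. Method of moving quadrics (triangular case): take a basis $p_1,\dots,p_n$ of the space of moving planes of degree $n-1$ that follow the surface, and choose $(n^2-n)/2$ moving quadrics of degree $n-1$ that follow the surface which, together with the $4n$ moving quadrics $X_ap_b$ ($1\le a\le4$, $1\le b\le n$), form a basis of the space of all moving quadrics of degree $n-1$ that follow the surface. Form the square matrix of size $n(n+1)/2$ whose columns correspond to these $n$ moving planes and $(n^2-n)/2$ moving quadrics, whose rows are indexed by the monomials $s^it^ju^{n-1-i-j}$, and whose entries are the coefficients (linear, respectively quadratic, forms in $X_1,\dots,X_4$) of these monomials. The output of the method is the determinant of this matrix. *)

(* Defs.v *)
From mathcomp Require Import all_boot all_order all_algebra.
From mathcomp Require Import reals.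
From mathcomp Require Import complex.
From mathcomp Require Import mpoly.

Set Implicit Arguments.
Unset Strict Implicit.
Unset Printing Implicit Defensive.

Import GRing.Theory.
Local Open Scope ring_scope.

(* Everything is defined over an arbitrary field K; the theorem takes K := R[i]
   with R : realType, i.e. the complex numbers.  The variables of
   {mpoly K[3]} are s, t, u and those of {mpoly K[4]} are X_1, ..., X_4. *)

Section MovingSurfaces.
Variable K : fieldType.

(* The pair (i, j) with i + j <= sigma is encoded as a bivariate multi-index;
   A m is then the form of degree d that multiplies s^i t^j u^(sigma-i-j). *)
Definition moving_surface (d sigma : nat) : vectType K :=
  {ffun 'X_{1..2 < sigma.+1} -> dhomog 4 K d}.

Definition stu_monomial (sigma : nat) (m : 'X_{1..2 < sigma.+1}) :
    {mpoly K[3]} :=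
  'X_[Multinom [tuple m ord0; m ord_max; (sigma - (m ord0 + m ord_max))%N]].

Definition substitute (x : 4.-tuple {mpoly K[3]}) (d sigma : nat)
    (A : moving_surface d sigma) : {mpoly K[3]} :=
  \sum_m (mpoly_of_dhomog (A m) \mPo x) * stu_monomial m.

Definition follows (x : 4.-tuple {mpoly K[3]}) (d sigma : nat) :
    {pred moving_surface d sigma} :=
  fun A => substitute x A == 0.
Arguments follows x d sigma : clear implicits.

Fact mulX_subproof (d : nat) (a : 'I_4) (f : dhomog 4 K d) :
  'X_a * mpoly_of_dhomog f \is d.+1.-homog.
Proof.
have Xhom : ('X_a : {mpoly K[4]}) \is 1.-homog by rewrite dhomogX /= mdeg1.
exact: dhomogM Xhom (dhomog_is_dhomog f).
Qed.

Definition mulX (d sigma : nat) (a : 'I_4) (A : moving_surface d sigma) :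
    moving_surface d.+1 sigma :=
  [ffun m => DHomog (mulX_subproof a (A m))].

Definition is_basis (V : vectType K) (S : {pred V}) (b : seq V) : Prop :=
  free b /\ <<b>>%VS =i S.

Definition no_base_points (x : 4.-tuple {mpoly K[3]}) : Prop :=
  forall pt : 'I_3 -> K, (exists i, pt i != 0) ->
    exists a : 'I_4, (tnth x a).@[pt] != 0.

(* Points of P^3 are represented by nonzero vectors of homogeneous
   coordinates. *)
Definition in_image (x : 4.-tuple {mpoly K[3]}) (v : 'I_4 -> K) : Prop :=
  (exists a, v a != 0) /\
  exists2 pt : 'I_3 -> K, (exists i, pt i != 0) &
    forall a, v a = (tnth x a).@[pt].

Definition contains_image (x : 4.-tuple {mpoly K[3]}) (G : {mpoly K[4]}) :
    Prop :=
  forall v, in_image x v -> G.@[v] = 0.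

Definition surface_equation (G : {mpoly K[4]}) : Prop :=
  G != 0 /\ exists2 d : nat, (0 < d)%N & G \is d.-homog.

Definition irreducible_mpoly (F : {mpoly K[4]}) : Prop :=
  [/\ F != 0, F \isn't a GRing.unit &
      forall G H : {mpoly K[4]}, F = G * H ->
        G \is a GRing.unit \/ H \is a GRing.unit].

(* F = 0 is the smallest surface containing the image: it contains the image,
   and its zero locus lies in that of every surface containing the image. *)
Definition implicit_equation (x : 4.-tuple {mpoly K[3]}) (F : {mpoly K[4]}) :
    Prop :=
  [/\ surface_equation F, irreducible_mpoly F, contains_image x F &
      forall G, surface_equation G -> contains_image x G ->
        forall v : 'I_4 -> K, (exists a, v a != 0) ->
          F.@[v] = 0 -> G.@[v] = 0].

Definition method_choice (x : 4.-tuple {mpoly K[3]}) (n : nat)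
    (p : n.-tuple (moving_surface 1 n.-1))
    (q : ((n ^ 2 - n)./2).-tuple (moving_surface 2 n.-1)) : Prop :=
  is_basis (follows x 1 n.-1) p /\
  is_basis (follows x 2 n.-1)
    (q ++ [seq mulX a b | a <- enum 'I_4, b <- p]).

End MovingSurfaces.

Arguments follows {K} x d sigma.

Lemma card_rows (n : nat) : (0 < n)%N ->
  #|{: 'X_{1..2 < n.-1.+1}}| = (n + (n ^ 2 - n)./2)%N.
Proof.
move=> n_gt0; rewrite prednK //.
have sumn2 (m : 'X_{1..2}) : mdeg m = (m ord0 + m ord_max)%N.
  rewrite mdegE big_ord_recl big_ord1; congr (_ + m _)%N; exact: val_inj.
have lt0 (m : 'X_{1..2 < n}) : (m ord0 < n)%N.
  by rewrite (leq_ltn_trans _ (bmdeg m)) // sumn2 leq_addr.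
have lt1 (m : 'X_{1..2 < n}) : (m ord_max < n)%N.
  by rewrite (leq_ltn_trans _ (bmdeg m)) // sumn2 leq_addl.
pose f (m : 'X_{1..2 < n}) : 'I_n * 'I_n := (Ordinal (lt0 m), Ordinal (lt1 m)).
have f_inj : injective f.
  move=> m m' [e0 e1]; apply/val_inj/mnmP => i.
  by have [->|->] : i = ord0 \/ i = ord_max
    by case: i => -[|[|//]] lti; [left | right]; apply: val_inj.
rewrite -(card_imset predT f_inj).
have -> : f @: predT = [set ij : 'I_n * 'I_n | (ij.1 + ij.2 < n)%N].
  apply/setP => -[i j]; rewrite inE /=; apply/imsetP/idP => [[m _ [-> ->]]|lt_ij].
    by rewrite /= -sumn2 bmdeg.
  have lt_m : (mdeg (Multinom [tuple val i; val j]) < n)%N by rewrite sumn2.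
  by exists (BMultinom lt_m); rewrite ?inE //; congr (_, _); apply: val_inj.
rewrite -sum1_card (eq_bigl (fun ij : 'I_n * 'I_n => ij.1 + ij.2 < n)%N); last first.
  by move=> ij; rewrite inE.
rewrite -(pair_big_dep xpredT (fun i j : 'I_n => i + j < n)%N (fun _ _ => 1%N)) /=.
transitivity (\sum_(i < n) (n - i))%N.
  apply: eq_bigr => i _.
  rewrite (eq_bigl (fun j : 'I_n => j < n - i)%N); last first.
    by move=> j; rewrite /= ltn_subRL.
  by rewrite -(big_ord_widen n (fun _ => 1%N) (leq_subr i n)) sum1_card card_ord.
elim: n {n_gt0 lt0 lt1 f f_inj} => [|n IHn]; first by rewrite big_ord0.
rewrite big_ord_recl /= subn0 (eq_bigr (fun i : 'I_n => n - i)%N); last first.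
  by move=> i _; rewrite /bump add1n subSS.
rewrite IHn; congr (_ + _)%N.
have -> : (n.+1 ^ 2 - n.+1 = n.*2 + (n ^ 2 - n))%N.
  case: n {IHn} => // n.
  have sqB m : (m.+1 ^ 2 - m.+1 = m.+1 * m)%N.
    by rewrite -mulnn -{3}[m.+1]muln1 -mulnBr subn1.
  by rewrite !sqB -muln2 -mulnDr mulnC add2n.
by rewrite halfD odd_double doubleK.
Qed.

(* n + (n^2 - n)/2 = n (n + 1) / 2.  Rows are the monomials, in the order of
   enum; columns are p_1, ..., p_n followed by the moving quadrics q_c. *)
Definition method_matrix (K : fieldType) (n : nat) (n_gt0 : (0 < n)%N)
    (p : n.-tuple (moving_surface K 1 n.-1))
    (q : ((n ^ 2 - n)./2).-tuple (moving_surface K 2 n.-1)) :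
    'M[{mpoly K[4]}]_(n + (n ^ 2 - n)./2) :=
  let row i := enum_val (cast_ord (esym (card_rows n_gt0)) i) in
  row_mx (\matrix_(i, b) mpoly_of_dhomog (tnth p b (row i)))
         (\matrix_(i, c) mpoly_of_dhomog (tnth q c (row i))).

(* Main.v *)
Require Import Defs.
From HB Require Import structures.
From mathcomp Require Import all_boot all_order all_algebra.
From mathcomp Require Import reals boolp.
From mathcomp Require Import complex.
From mathcomp Require Import mpoly.
From mathcomp Require Import ring zify.

(* Having exactly n moving planes of degree n-1 means, by counting
   dimensions, that (g_a) |-> sum g_a x_a maps onto the forms of degree
   2n-1; hence moving quadrics map onto degree 3n-1, and their number is known.
   The n 4 products X_a p_b are independent: a relation gives an alternating 4x4
   matrix of forms of degree n-1 killed by x, and exactness of the Koszul complex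
   of x writes its Hodge dual as w /\ x, with w of degree -1, that is w = 0.

   Suppose F(v) <> 0.  Let y be the linear forms vanishing at v, evaluated at x.
   Since F(x) = 0, a power of s, t and u lies in the ideal (y), so the first
   Koszul homology of y vanishes.  A kernel vector of the matrix at v is a
   following quadric that vanishes at X = v; by Koszul exactness it is a
   combination of following planes multiplied by X_a, against independence.  So
   the zeros of the determinant are zeros of F.  By the Nullstellensatz for
   hypersurfaces every prime factor of the determinant divides F, hence is F up
   to a constant; there is at least one because the determinant vanishes at
   X = 0. *)

Set Implicit Arguments.
Unset Strict Implicit.
Unset Printing Implicit Defensive.

Import GRing.Theory.
Local Open Scope ring_scope.

(** * Unique factorization in polynomial rings *)

Section Divisibility.
Variable A : idomainType.
Implicit Types (a b p q u : A) (s : seq A).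

Definition divides a b := exists c, b = c * a.

Definition prime_elt p :=
  [/\ p != 0, p \isn't a GRing.unit &
      forall a b, divides p (a * b) -> divides p a \/ divides p b].

(** The factors are required to be prime, not merely irreducible; uniqueness up to units is then
    automatic, so only existence is asked. *)
Definition factorial :=
  forall a, a != 0 -> exists u s,
    [/\ u \is a GRing.unit, forall p, p \in s -> prime_elt p
      & a = u * \prod_(p <- s) p].

Lemma divides0 a : divides a 0.
Proof. by exists 0; rewrite mul0r. Qed.

Lemma divides_mull a b c : divides a b -> divides a (c * b).
Proof. by case=> d ->; exists (c * d); rewrite mulrA. Qed.

Lemma dividesD a b c : divides a b -> divides a c -> divides a (b + c).
Proof. by case=> d -> [e ->]; exists (d + e); rewrite mulrDl. Qed.

Lemma dividesB a b c : divides a b -> divides a c -> divides a (b - c).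
Proof. by case=> d -> [e ->]; exists (d - e); rewrite mulrBl. Qed.

Lemma divides_trans b a c : divides a b -> divides b c -> divides a c.
Proof. by case=> d -> [e ->]; exists (e * d); rewrite mulrA. Qed.

Lemma prime_nunit p u : prime_elt p -> u \is a GRing.unit -> ~ divides p u.
Proof.
by move=> [_ /negP pN _] uU [c e]; apply: pN; move: uU; rewrite e unitrM => /andP[].
Qed.

Lemma prime_divides_prod p u s : prime_elt p -> u \is a GRing.unit ->
  divides p (u * \prod_(q <- s) q) -> exists2 q, q \in s & divides p q.
Proof.
move=> pP uU; elim: s => [|q s IHs].
  by rewrite big_nil mulr1 => /(prime_nunit pP uU).
rewrite big_cons mulrCA; case: pP => [_ _ pP] /pP[|/IHs[r rs pr]].
  by exists q; rewrite ?mem_head.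
by exists r; rewrite // inE rs orbT.
Qed.

(** In [q = c * p] the prime [q] divides [c] or [p]; if it divided [c], cancelling [q] would make
    [p] a unit. *)
Lemma prime_divides_sym p q : prime_elt p -> prime_elt q ->
  divides p q -> divides q p.
Proof.
move=> [p0 pN _] [q0 _ qP] [c e].
have [|[d ec]|//] := qP c p; first by rewrite -e; exists 1; rewrite mul1r.
case/negP: pN; apply/unitrPr; exists d.
by apply: (mulfI q0); rewrite mulr1 mulrA mulrAC -mulrA mulrC {2}e ec; ring.
Qed.

End Divisibility.

Lemma factorial_iso (A B : idomainType) (f : {rmorphism A -> B})
    (g : {rmorphism B -> A}) :
  cancel f g -> cancel g f -> factorial A -> factorial B.
Proof.
move=> fK gK hA b b0.
have [|u [s [uU sP e]]] := hA (g b).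
  by apply: contraNneq b0 => e; rewrite -(gK b) e rmorph0.
exists (f u), (map f s); split; first exact: rmorph_unit.
- move=> _ /mapP[p /sP[p0 pN pP] ->]; split.
  + by apply: contraNneq p0 => e'; rewrite -(fK p) e' rmorph0.
  + by apply: contra pN => pN; rewrite -(fK p) rmorph_unit.
  + move=> a c [d e']; have [|[k ek]|[k ek]] := pP (g a) (g c).
    * by exists (g d); rewrite -rmorphM e' rmorphM fK.
    * by left; exists (f k); rewrite -(gK a) ek rmorphM.
    * by right; exists (f k); rewrite -(gK c) ek rmorphM.
- by rewrite -(gK b) e rmorphM rmorph_prod big_map.
Qed.

Section Gauss.
Variable A : idomainType.
Implicit Types (p c : A) (f g h : {poly A}).

Lemma dividesCP p f : divides p%:P f <-> forall i, divides p f`_i.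
Proof.
split=> [[g ->] i|]; first by exists g`_i; rewrite coefMC.
elim/poly_ind: f => [_|f c IHf pf]; first exact: divides0.
apply: dividesD.
  rewrite mulrC; apply/divides_mull/IHf => i.
  by have := pf i.+1; rewrite coefD coefMX coefC addr0.
have := pf 0%N; rewrite coefD coefMX coefC add0r => -[d ->].
by exists d%:P; rewrite polyCM.
Qed.

Lemma unit_polyC p : (p%:P \is a GRing.unit) = (p \is a GRing.unit).
Proof.
by rewrite poly_unitE coefC size_polyC; case: (eqVneq p 0) => // ->; rewrite unitr0.
Qed.

Lemma size_unit_poly f : f \is a GRing.unit -> size f = 1%N.
Proof. by rewrite poly_unitE => /andP[/eqP]. Qed.

(** Gauss's lemma. [p] divides the product of the leading coefficients, hence one of them; removing
    that leading term keeps the product divisible by [p] and lowers [size a + size b]. *)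
Lemma prime_polyC p : prime_elt p -> prime_elt p%:P.
Proof.
move=> pP; split.
- by rewrite polyC_eq0; case: pP.
- by rewrite unit_polyC; case: pP.
move=> a b; have [n] := ubnP (size a + size b); elim: n a b => // n IHn a b.
rewrite ltnS => le_n pab.
have [->|a0] := eqVneq a 0; first by left; apply: divides0.
have [->|b0] := eqVneq b 0; first by right; apply: divides0.
have split_lead h : h != 0 -> exists2 h', h = lead_coef h *: 'X^((size h).-1) + h' &
    (size h' < size h)%N.
  move=> h0; exists (\poly_(i < (size h).-1) h`_i); last first.
    by rewrite (leq_ltn_trans (size_poly _ _)) // prednK ?leqnn // size_poly_gt0.
  rewrite -[LHS]coefK; have := h0; rewrite -size_poly_gt0 lead_coefE.
  by case: (size h) => // m _ /=; rewrite poly_def big_ord_recr /= addrC -poly_def.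
have : divides p (lead_coef a * lead_coef b).
  by rewrite -lead_coefM lead_coefE; move/dividesCP: pab; apply.
have pZ c f : divides p c -> divides p%:P (c *: f).
  by case=> d ->; exists (d *: f); rewrite -!mul_polyC polyCM; ring.
case: pP => _ _ pP; case/pP=> pl.
  have [a' ea lt_a] := split_lead a a0; have := pZ _ 'X^((size a).-1) pl.
  set t := lead_coef a *: _ in ea * => pa.
  have [||pa'|] := IHn a' b; [by lia| |left|by right].
    have -> : a' * b = a * b - b * t by rewrite {1}ea; ring.
    by apply: dividesB => //; apply: divides_mull.
  by rewrite ea; apply: dividesD.
have [b' eb lt_b] := split_lead b b0; have := pZ _ 'X^((size b).-1) pl.
set t := lead_coef b *: _ in eb * => pb.
have [|||pb'] := IHn a b'; [by lia| |by left|right].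
  have -> : a * b' = a * b - a * t by rewrite {1}eb; ring.
  by apply: dividesB => //; apply: divides_mull.
by rewrite eb; apply: dividesD.
Qed.

(** [irreducible_poly] refers to division up to nonzero scalars, that is, over the fraction field of
    [A]. In [c *: h = k * q] the prime [h] divides [k] or [q]; by degrees it divides [q], and [k] is
    constant. *)
Lemma prime_poly_irreducible h : prime_elt h -> (1 < size h)%N ->
  irreducible_poly h.
Proof.
move=> [h0 hN hP] gt1; split=> // q q1 /Pdiv.WeakIdomain.dvdpP[[c k] /= c0 e].
have k0 : k != 0.
  by apply: contraNneq h0 => k0; move/eqP: e; rewrite k0 mul0r scale_poly_eq0 (negPf c0).
have q0 : q != 0.
  by apply: contraNneq h0 => q0; move/eqP: e; rewrite q0 mulr0 scale_poly_eq0 (negPf c0).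
have sz : size h = (size k + size q).-1 by rewrite -size_mul // -e size_scale.
have := size_poly_gt0 k; have := size_poly_gt0 q; rewrite k0 q0 => q_gt0 k_gt0.
have [||[m em]] := hP k q; first by rewrite -e -mul_polyC; exists c%:P.
  move=> [m em]; have m0 : m != 0 by apply: contraNneq k0 => m0; rewrite em m0 mul0r.
  by move: sz q1; rewrite em size_mul //; have := size_poly_gt0 m; rewrite m0; lia.
have m0 : m != 0 by apply: contraNneq q0 => m0; rewrite em m0 mul0r.
have /eqP/size_poly1P[d d0 ed] : size k = 1%N.
  by move: sz; rewrite em size_mul //; have := size_poly_gt0 m; rewrite m0; lia.
by apply/eqpP; exists (d, c); rewrite /= ?c0 ?d0 // e ed mul_polyC.
Qed.

(** Over the fraction field the gcd of [h] and [f] is 1 or [h]. The first case is a Bezout identity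
    with denominators cleared; in the second [h] divides a constant times [f], hence [f]. *)
Lemma prime_poly_bezout h f : prime_elt h -> (1 < size h)%N -> ~ divides h f ->
  exists k l c, c != 0 /\ k * h + l * f = c%:P.
Proof.
move=> hP gt1 hN; have irr := prime_poly_irreducible hP gt1.
have [|gcdh] := irredp_XsubCP irr (dvdp_gcdl h f); last first.
  have : h %| f by rewrite -(eqp_dvdl _ gcdh) dvdp_gcdr.
  case/Pdiv.WeakIdomain.dvdpP=> -[c k] /= c0 e; have [_ _ hP'] := hP.
  have [|[d ed]|/hN//] := hP' c%:P f; first by rewrite mul_polyC e; exists k.
  have d0 : d != 0 by apply: contraNneq c0 => d0; rewrite -polyC_eq0 ed d0 mul0r.
  have h0 : h != 0 by case: hP.
  have := congr1 (fun p : {poly _} => size p) ed.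
  rewrite size_polyC c0 size_mul //.
  by have := size_poly_gt0 d; rewrite d0; lia.
rewrite gcdp_eqp1 => /Bezout_coprimepP[[k l] /= /eqpP[[c1 c2] /= /andP[_ c20] e]].
exists (c1 *: k), (c1 *: l), c2; split=> //.
by rewrite -!scalerAl -scalerDr e alg_polyC.
Qed.

(* Primes of [A] stay prime in [{poly A}], so a denominator [c] can be cleared
   one prime factor at a time. *)
Lemma clear_denominator c u s f g h : u \is a GRing.unit ->
    (forall p, p \in s -> prime_elt p) -> c = u * \prod_(p <- s) p ->
    (forall p, p \in s -> ~ divides p%:P f) -> c *: g = h * f ->
  divides f g.
Proof.
elim: s c h => [|p s IHs] c h uU sP ec sN e.
  exists (u^-1 *: h); rewrite -scalerAl -e ec big_nil mulr1 scalerA mulVr //.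
  by rewrite scale1r.
have pP := sP p (mem_head _ _).
have [p0 _ _] := pP; have [_ _ pP'] := prime_polyC pP.
have [|[k ek]|/(sN p (mem_head _ _))//] := pP' h f.
  rewrite -e ec big_cons; exists ((u * \prod_(q <- s) q) *: g).
  by rewrite -!mul_polyC !polyCM; ring.
apply: (IHs (u * \prod_(q <- s) q) k) => // [q qs|q qs|].
- by apply: sP; rewrite inE qs orbT.
- by apply: sN; rewrite inE qs orbT.
have pC0 : p%:P != 0 by rewrite polyC_eq0.
apply: (mulfI pC0); rewrite mulrA (mulrC _ k) -ek -e ec big_cons.
by rewrite -!mul_polyC !polyCM; ring.
Qed.

(** A factorization over the fraction field descends to [{poly A}]: each prime factor of [c] divides
    [g] or [h] and is cancelled there; being constant, it leaves the sizes unchanged. *)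
Lemma split_denominator c u s f g h : u \is a GRing.unit ->
    (forall p, p \in s -> prime_elt p) -> c = u * \prod_(p <- s) p ->
    c *: f = g * h ->
  exists g' h', [/\ f = g' * h', size g' = size g & size h' = size h].
Proof.
elim: s c g h => [|p s IHs] c g h uU sP ec e.
  exists (u^-1 *: g), h; split=> //; last first.
    by rewrite size_scale // invr_eq0; apply: contraTneq uU => ->; rewrite unitr0.
  rewrite -scalerAl -e ec big_nil mulr1 scalerA mulVr //.
  by rewrite scale1r.
have pP := sP p (mem_head _ _).
have [p0 _ _] := pP; have [_ _ pP'] := prime_polyC pP.
have pC0 : p%:P != 0 by rewrite polyC_eq0.
have sP' q : q \in s -> prime_elt q by move=> qs; apply: sP; rewrite inE qs orbT.
have szp k : size (k * p%:P) = size k by rewrite mulrC mul_polyC size_scale.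
have e' : p%:P * ((u * \prod_(q <- s) q) *: f) = g * h.
  by rewrite -e ec big_cons -!mul_polyC !polyCM; ring.
have [|[k ek]|[k ek]] := pP' g h.
- by rewrite -e'; exists ((u * \prod_(q <- s) q) *: f); rewrite mulrC.
- rewrite ek szp; apply: (IHs (u * \prod_(q <- s) q)) => //.
  by apply: (mulfI pC0); rewrite e' ek; ring.
- rewrite ek szp; apply: (IHs (u * \prod_(q <- s) q)) => //.
  by apply: (mulfI pC0); rewrite e' ek; ring.
Qed.

(** A constant prime dividing [f] divides its leading coefficient, so primitivity need only be
    tested on [s]. For a primitive [f], being divisible by [f] over the fraction field and in
    [{poly A}] agree, and primality comes from coprimality over the field. *)
Lemma primitive_irreducible_prime f u s : factorial A -> u \is a GRing.unit ->
    (forall p, p \in s -> prime_elt p) -> lead_coef f = u * \prod_(p <- s) p ->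
    (forall p, p \in s -> ~ divides p%:P f) -> (1 < size f)%N ->
    ~ (exists g h, [/\ f = g * h, (1 < size g)%N & (1 < size h)%N]) ->
  prime_elt f.
Proof.
move=> hA uU sP el sN gt1 f_irr.
have f0 : f != 0 by rewrite -size_poly_gt0 ltnW.
have irr : irreducible_poly f.
  split=> // q q1 /Pdiv.WeakIdomain.dvdpP[[c k] /= c0 e].
  have k0 : k != 0.
    by apply: contraNneq f0 => k0; move/eqP: e; rewrite k0 mul0r scale_poly_eq0 (negPf c0).
  have q0 : q != 0.
    by apply: contraNneq f0 => q0; move/eqP: e; rewrite q0 mulr0 scale_poly_eq0 (negPf c0).
  have [v [r [vU rP ec]]] := hA c c0.
  have [k' [q' [ef szk szq]]] := split_denominator vU rP ec e.
  have /eqP/size_poly1P[d d0 ed] : size k = 1%N.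
    move: k0 q0; rewrite -!size_poly_gt0 => k0 q0.
    have [//|kN1] := eqVneq (size k) 1%N; case: f_irr; exists k', q'; split=> //; lia.
  by apply/eqpP; exists (d, c); rewrite /= ?c0 ?d0 // e ed mul_polyC.
have sN' p : prime_elt p -> ~ divides p%:P f.
  move=> pP pf; have [|q qs pq] := @prime_divides_prod _ p u s pP uU.
    by rewrite -el lead_coefE; move/dividesCP: pf; apply.
  apply: (sN q qs); apply: divides_trans pf.
  have [d ->] := prime_divides_sym pP (sP q qs) pq.
  by exists d%:P; rewrite polyCM.
have dvd g : f %| g -> divides f g.
  case/Pdiv.WeakIdomain.dvdpP=> -[c k] /= c0 e; have [v [r [vU rP ec]]] := hA c c0.
  by apply: (clear_denominator vU rP ec _ e) => p pr; apply/sN'/rP.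
split=> //; first by apply/negP => /size_unit_poly e; rewrite e in gt1.
move=> a b [c e]; have fab : f %| a * b by rewrite e dvdp_mull.
have [|gcdf] := irredp_XsubCP irr (dvdp_gcdl f a).
  by rewrite gcdp_eqp1 => cop; right; apply: dvd; rewrite -(Gauss_dvdpr _ cop).
by left; apply: dvd; rewrite -(eqp_dvdl _ gcdf) dvdp_gcdr.
Qed.

Theorem factorial_poly : factorial A -> factorial {poly A}.
Proof.
move=> hA f; have [n] := ubnP (size f); elim: n f => // n IHn f.
rewrite ltnS => le_n f0.
have [u [s [uU sP el]]] : exists u s, [/\ u \is a GRing.unit,
    forall p, p \in s -> prime_elt p & lead_coef f = u * \prod_(p <- s) p].
  by apply: hA; rewrite lead_coef_eq0.
(* Inner induction on the number of primes in the leading coefficient: dividing out a constant prime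
   shortens this list and keeps the size of [f], while a proper splitting lowers the size. *)
have [m] := ubnP (size s); elim: m s f sP el le_n f0 => // m IHm s f sP el le_n f0.
rewrite ltnS => le_m.
have [gt1|le1] := ltnP 1 (size f); last first.
  have ef := size1_polyC le1.
  have [|v [r [vU rP ec]]] := hA f`_0.
    by apply: contraNneq f0 => e; rewrite ef e.
  exists v%:P, (map polyC r); split; first by rewrite unit_polyC.
    by move=> _ /mapP[p /rP pP ->]; apply: prime_polyC.
  by rewrite ef ec polyCM rmorph_prod big_map.
have [[p [ps [g eg]]]|sN] := EM (exists p, p \in s /\ divides p%:P f).
  have [p0 _ _] := sP p ps.
  have g0 : g != 0 by apply: contraNneq f0 => g0; rewrite eg g0 mul0r.
  have [|||||v [r [vU rP er]]] := IHm (rem p s) g.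
  - by move=> q /mem_rem /sP.
  - apply: (mulIf p0); rewrite -{1}(lead_coefC p) -lead_coefM -eg el.
    by rewrite (perm_big _ (perm_to_rem ps)) big_cons /=; ring.
  - by move: le_n; rewrite eg mulrC mul_polyC size_scale.
  - by [].
  - by rewrite size_rem // prednK //; case: (s) ps.
  exists v, (p%:P :: r); split=> //.
    by move=> q; rewrite inE => /predU1P[->|/rP//]; apply/prime_polyC/sP.
  by rewrite eg er big_cons; ring.
have [[g [h [efgh g1 h1]]]|f_irr] :=
    EM (exists g h, [/\ f = g * h, (1 < size g)%N & (1 < size h)%N]).
  have g0 : g != 0 by rewrite -size_poly_gt0 ltnW.
  have h0 : h != 0 by rewrite -size_poly_gt0 ltnW.
  move: le_n; rewrite efgh size_mul // => le_n.
  have [||v [r [vU rP er]]] := IHn g; [by lia|by []|].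
  have [||w [t [wU tP et]]] := IHn h; [by lia|by []|].
  exists (v * w), (r ++ t); split; first by rewrite unitrM vU.
    by move=> q; rewrite mem_cat => /orP[/rP|/tP].
  by rewrite er et big_cat /=; ring.
exists 1, [:: f]; split; rewrite ?unitr1 ?big_seq1 ?mul1r // => q.
rewrite inE => /eqP->; apply: (primitive_irreducible_prime hA uU sP el) => //.
by move=> p ps pf; apply: sN; exists p.
Qed.

End Gauss.

(** * Hypersurfaces over an algebraically closed field *)

Lemma mpoly_rmorph_eq n (R : comNzRingType) (S : comNzRingType)
    (f g : {rmorphism {mpoly R[n]} -> S}) :
  (forall c, f c%:MP = g c%:MP) -> (forall i, f 'X_i = g 'X_i) -> f =1 g.
Proof.
move=> fgC fgX p; elim/mpolyind: p => [|c m p _ _ IHp]; first by rewrite !rmorph0.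
rewrite !rmorphD /= IHp; congr (_ + _).
rewrite -mul_mpolyC !rmorphM /= fgC mpolyXE_id !rmorph_prod; congr (_ * _).
by apply: eq_bigr => i _; rewrite !rmorphXn /= fgX.
Qed.

Lemma mpoly_unitP (K : fieldType) n (p : {mpoly K[n]}) :
  reflect (exists2 c, c != 0 & p = c%:MP) (p \is a GRing.unit).
Proof.
apply: (iffP andP) => [[/eqP ep]|[c c0 ->]].
  by rewrite unitfE => c0; exists p@_0.
by rewrite mcoeffC eqxx mulr1 eqxx unitfE.
Qed.

Local Notation widen := (widen_ord (leqnSn _)).

Section LastVariable.
Variables (n : nat) (R : idomainType).

Lemma muniX_widen (i : 'I_n) :
  muni ('X_(widen i) : {mpoly R[n.+1]}) = ('X_i)%:P.
Proof.
rewrite muniE msuppX big_seq1 mcoeffX eqxx scale1r.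
have -> : [multinom (U_(widen i))%MM (widen j) | j < n] = U_(i)%MM.
  by apply/mnmP => j; rewrite mnmE !mnm1E -!val_eqE.
by rewrite mnm1E -val_eqE /= ltn_eqF // expr0 alg_polyC.
Qed.

Lemma muniX_max : muni ('X_ord_max : {mpoly R[n.+1]}) = 'X.
Proof.
rewrite muniE msuppX big_seq1 mcoeffX eqxx scale1r.
have -> : [multinom (U_(ord_max))%MM (widen j) | j < n] = 0%MM.
  by apply/mnmP => j; rewrite mnmE mnm1E mnm0E -val_eqE /= gtn_eqF.
by rewrite mnm1E eqxx expr1 mpolyX0 scale1r.
Qed.

Lemma ord_widen_max (P : 'I_n.+1 -> Prop) :
  (forall i : 'I_n, P (widen i)) -> P ord_max -> forall i, P i.
Proof.
move=> Pw Pm i; case: (unliftP ord_max i) => [j ->|-> //].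
by have -> : lift ord_max j = widen j by apply: val_inj; exact: lift_max.
Qed.

Fact unmuni_subproof : commr_rmorph (@mwiden n R) 'X_ord_max.
Proof. by move=> c; apply: mulrC. Qed.

(** Inverse of [muni], which reads a polynomial in [n + 1] variables as a univariate one in the last
    variable. *)
Definition unmuni : {poly {mpoly R[n]}} -> {mpoly R[n.+1]} :=
  horner_morph unmuni_subproof.

HB.instance Definition _ := GRing.RMorphism.on unmuni.

Lemma unmuniC c : unmuni c%:P = mwiden c.
Proof. exact: horner_morphC. Qed.

Lemma unmuniX : unmuni 'X = 'X_ord_max.
Proof. exact: horner_morphX. Qed.

Lemma muniK : cancel (@muni n R) unmuni.
Proof.
apply: (@mpoly_rmorph_eq _ _ _ (unmuni \o @muni n R) idfun) => /= [c|].
  by rewrite muniC unmuniC mwidenC.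
apply: ord_widen_max => [i|]; last by rewrite muniX_max unmuniX.
by rewrite muniX_widen unmuniC mwidenX mnmwiden1.
Qed.

Lemma unmuniK : cancel unmuni (@muni n R).
Proof.
have muni_mwiden (c : {mpoly R[n]}) : muni (mwiden c) = c%:P.
  move: c; apply: (@mpoly_rmorph_eq _ _ _ (@muni n R \o @mwiden n R) polyC) => /= [c|i].
    by rewrite mwidenC muniC.
  by rewrite mwidenX mnmwiden1 muniX_widen.
elim/poly_ind => [|q c IHq]; first by rewrite !rmorph0.
by rewrite !rmorphD !rmorphM /= IHq unmuniC unmuniX muniX_max muni_mwiden.
Qed.

Lemma meval_muni (v : 'I_n.+1 -> R) (p : {mpoly R[n.+1]}) :
  p.@[v] = (map_poly (meval (v \o widen)) (muni p)).[v ord_max].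
Proof.
move: p; apply: (@mpoly_rmorph_eq _ _ _ (meval v)
  (horner_eval (v ord_max) \o (map_poly (meval (v \o widen)) \o @muni n R))) => /= [c|].
  by rewrite mevalC muniC map_polyC /= mevalC /horner_eval hornerC.
apply: ord_widen_max => [i|]; rewrite mevalXU.
  by rewrite muniX_widen map_polyC /= mevalXU /horner_eval hornerC.
by rewrite muniX_max map_polyX /horner_eval hornerX.
Qed.

End LastVariable.

Theorem factorial_mpoly (K : fieldType) n : factorial {mpoly K[n]}.
Proof.
elim: n => [|n IHn]; last first.
  exact: factorial_iso (@unmuniK n K) (@muniK n K) (factorial_poly IHn).
move=> a a0; exists a, [::]; rewrite big_nil mulr1; split=> //.
apply/mpoly_unitP; exists a@_0; last by rewrite mpolyKC.
by apply: contraNneq a0 => e; rewrite -(mpolyKC a) e mpolyC0.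
Qed.

Lemma bezout_eval (A S : idomainType) (m : {rmorphism A -> S}) (x : S)
    (h f k l : {poly A}) (c : A) :
    k * h + l * f = c%:P -> (map_poly m h).[x] = 0 -> (map_poly m f).[x] = 0 ->
  m c = 0.
Proof.
move=> e hx fx; have := congr1 (fun p => (map_poly m p).[x]) e.
by rewrite rmorphD !rmorphM hornerD !hornerM hx fx !mulr0 addr0 map_polyC hornerC.
Qed.

Section Nullstellensatz.
Variable K : closedFieldType.

Lemma poly_fun_eq0 (p : {poly K}) : (forall x, p.[x] = 0) -> p = 0.
Proof.
move=> p0; apply/eqP; apply: contraT => pN0.
have /closed_nonrootP[x] := pN0.
by rewrite /root p0 eqxx.
Qed.

Definition extend n (v : 'I_n -> K) (x : K) (i : 'I_n.+1) : K :=
  if unlift ord_max i is Some j then v j else x.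

Lemma meval_extend n (v : 'I_n -> K) x (p : {mpoly K[n.+1]}) :
  p.@[extend v x] = (map_poly (meval v) (muni p)).[x].
Proof.
rewrite meval_muni {2}/extend unlift_none; congr horner.
apply: eq_map_poly => c; apply: meval_eq => i /=.
have -> : widen i = lift ord_max i by apply: val_inj; symmetry; exact: lift_max.
by rewrite /extend liftK.
Qed.

Lemma mpoly_fun_eq0 n (p : {mpoly K[n]}) : (forall v, p.@[v] = 0) -> p = 0.
Proof.
elim: n p => [|n IHn] p p0.
  have := p0 (fun=> 0); rewrite -[p in LHS]mpolyKC mevalC => e.
  by rewrite -(mpolyKC p) e mpolyC0.
apply: (can_inj (@muniK n K)); rewrite rmorph0; apply/polyP => i.
rewrite coef0; apply: IHn => v; rewrite -coef_map.
suff -> : map_poly (meval v) (muni p) = 0 by rewrite coef0.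
by apply: poly_fun_eq0 => x; rewrite -meval_extend.
Qed.

Theorem prime_nullstellensatz n (H F : {mpoly K[n]}) : prime_elt H ->
  (forall v, H.@[v] = 0 -> F.@[v] = 0) -> divides H F.
Proof.
elim: n H F => [|n IHn] H F HP HF.
  have [H0 /negP[]] := HP; apply/mpoly_unitP; exists H@_0; last by rewrite mpolyKC.
  by apply: contraNneq H0 => e; rewrite -(mpolyKC H) e mpolyC0.
suff [g eg] : divides (muni H) (muni F).
  by exists (unmuni g); rewrite -(muniK F) eg rmorphM /= muniK.
have hP : prime_elt (muni H).
  case: HP => H0 HN HP; split.
  - by apply: contraNneq H0 => e; rewrite -(muniK H) e rmorph0.
  - by apply: contra HN => e; rewrite -(muniK H) rmorph_unit.
  - move=> a b [c e]; have [|[k ek]|[k ek]] := HP (unmuni a) (unmuni b).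
    + by exists (unmuni c); rewrite -rmorphM e rmorphM /= muniK.
    + by left; exists (muni k); rewrite -(unmuniK a) ek rmorphM.
    + by right; exists (muni k); rewrite -(unmuniK b) ek rmorphM.
have h0 : muni H != 0 by case: hP.
(* If [H] is free of the last variable, [F] vanishes on the whole line above each zero of [H], so
   all its coefficients vanish at that zero and induction applies to each of them. *)
have [gt1|le1] := ltnP 1 (size (muni H)); last first.
  have eh := size1_polyC le1; move: hP h0; rewrite eh polyC_eq0.
  move: (muni H)`_0 eh => a eh [_ aN aP] a0; apply/dividesCP => i; apply: IHn.
    split=> //; first by rewrite -unit_polyC.
    have dC b : divides a%:P b%:P -> divides a b.
      by move/dividesCP/(_ 0%N); rewrite coefC.
    move=> b c [d e]; have [|/dC|/dC] := aP b%:P c%:P; [|by left|by right].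
    by exists d%:P; rewrite -!polyCM e.
  move=> v av; rewrite -coef_map.
  suff -> : map_poly (meval v) (muni F) = 0 by rewrite coef0.
  apply: poly_fun_eq0 => x; rewrite -meval_extend; apply: HF.
  by rewrite meval_extend eh map_polyC /= av hornerC.
have [//|hN] := EM (divides (muni H) (muni F)).
have [k [l [c [c0 e]]]] := prime_poly_bezout hP gt1 hN.
(* Where the leading coefficient of [H] does not vanish, [H] keeps positive degree and has a root in
   the last variable; [F] vanishes there too, which forces [c] to vanish at [v]. *)
have [v] : exists v, (c * lead_coef (muni H)).@[v] != 0.
  apply: contrapT => all0.
  have /eqP[] : c * lead_coef (muni H) != 0 by rewrite mulf_neq0 // lead_coef_eq0.
  by apply: mpoly_fun_eq0 => v; apply/eqP; apply: contrapT => /negP n0; case: all0; exists v.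
rewrite mevalM mulf_eq0 negb_or => /andP[cv lv].
have szv : size (map_poly (meval v) (muni H)) = size (muni H).
  by rewrite size_map_poly_id0.
have /closed_rootP[x /rootP Hx] : size (map_poly (meval v) (muni H)) != 1%N.
  by rewrite szv gtn_eqF.
have Hv : H.@[extend v x] = 0 by rewrite meval_extend.
have Fv := HF _ Hv; rewrite meval_extend in Hv; rewrite meval_extend in Fv.
have cv0 := bezout_eval e Hv Fv.
by move: cv; rewrite cv0 eqxx.
Qed.

(** The zeros of a prime factor of [G] are zeros of [F], so this factor divides [F] and, by
    irreducibility, is a constant multiple of it. The exponent is 0 when [G] is constant. *)
Theorem zero_locus_power n (G F : {mpoly K[n]}) :
    G != 0 ->
    (forall P Q : {mpoly K[n]}, F = P * Q ->
       P \is a GRing.unit \/ Q \is a GRing.unit) ->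
    (forall v, G.@[v] = 0 -> F.@[v] = 0) ->
  exists (c : K) (k : nat), c != 0 /\ G = c *: F ^+ k.
Proof.
move=> G0 Firr GF; have [u [s [/mpoly_unitP[c c0 ->] sP eG]]] := factorial_mpoly G0.
have {}GF p v : p \in s -> p.@[v] = 0 -> F.@[v] = 0.
  move=> ps pv; apply: GF; rewrite eG mevalM (perm_big _ (perm_to_rem ps)).
  by rewrite big_cons /= mevalM pv mul0r mulr0.
rewrite {}eG.
have : exists (d : K) (k : nat), d != 0 /\ \prod_(p <- s) p = d *: F ^+ k.
  elim: s sP GF => [|p s IHs] sP GF.
    by exists 1, 0%N; rewrite oner_eq0 big_nil expr0 scale1r.
  have [||d [k [d0 ek]]] := IHs.
  - by move=> q qs; apply: sP; rewrite inE qs orbT.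
  - by move=> q v qs; apply: GF; rewrite inE qs orbT.
  have pP := sP p (mem_head _ _).
  have [m em] := prime_nullstellensatz pP (fun v => GF p v (mem_head _ _)).
  have [/mpoly_unitP[b b0 eb]|] := Firr _ _ em; last by case: pP => _ /negP.
  exists (b^-1 * d), k.+1; rewrite mulf_neq0 ?invr_eq0 //; split=> //.
  rewrite big_cons ek -scalerA -scalerAr exprS {2}em eb mul_mpolyC -scalerAl.
  by rewrite !scalerA; congr (_ *: _); rewrite mulrAC mulVf ?mul1r.
case=> d [k [d0 ek]]; exists (c * d), k; rewrite mulf_neq0 //; split=> //.
by rewrite mul_mpolyC ek scalerA.
Qed.

End Nullstellensatz.

(** * Koszul exactness *)

Section Koszul.
Variables (A : idomainType) (I : finType) (e1 e2 e3 : A) (x h1 h2 h3 : I -> A).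

Hypothesis e1_neq0 : e1 != 0.
Hypothesis e2_regular : forall m a, e2 * m = e1 * a -> exists b, m = e1 * b.
Hypothesis e3_regular : forall m a b, e3 * m = e1 * a + e2 * b ->
  exists c d, m = e1 * c + e2 * d.
Hypothesis e1_in : e1 = \sum_a h1 a * x a.
Hypothesis e2_in : e2 = \sum_a h2 a * x a.
Hypothesis e3_in : e3 = \sum_a h3 a * x a.

Lemma koszul_coordinate : exists a, x a != 0.
Proof.
apply: contrapT => x0; case/eqP: e1_neq0; rewrite e1_in big1 // => a _.
by have [->|xa] := eqVneq (x a) 0; [rewrite mulr0 | case: x0; exists a].
Qed.

(** As each [e] lies in the ideal of [x], [e1 * w] and [e2 * w] are multiples [m1], [m2] of [x].
    Then [e2 * m1 = e1 * m2], so regularity gives [m1 = e1 * c]. *)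
Lemma koszul_exact1 (w : I -> A) : (forall a b, w a * x b = w b * x a) ->
  exists c, forall a, w a = c * x a.
Proof.
move=> wx.
have hom h e : e = \sum_a h a * x a -> forall a, e * w a = (\sum_b h b * w b) * x a.
  move=> -> a; rewrite !mulr_suml; apply: eq_bigr => b _.
  by rewrite -mulrA (mulrC (x b)) wx mulrA.
have w1 := hom _ _ e1_in; have w2 := hom _ _ e2_in.
have [a0 xa0] := koszul_coordinate.
have [|c ec] := @e2_regular (\sum_b h1 b * w b) (\sum_b h2 b * w b).
  by apply: (mulIf xa0); rewrite -mulrA -w1 -[RHS]mulrA -w2 mulrCA.
by exists c => a; apply: (mulfI e1_neq0); rewrite w1 ec mulrA.
Qed.

(** Contracting with [h1], [h2], [h3] writes each [e_i * g] as the wedge of some [w_i] with [x]. By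
    [koszul_exact1] the [w_i] agree up to multiples of [x], and regularity lets [w1], corrected by a
    multiple of [x], be divided by [e1]. *)
Lemma koszul_exact2 (g : I -> I -> A) : (forall a b, g a b = - g b a) ->
    (forall a b c, g a b * x c + g b c * x a + g c a * x b = 0) ->
  exists w, forall a b, g a b = w a * x b - w b * x a.
Proof.
move=> gN gx.
have hom h e : e = \sum_a h a * x a ->
    exists w, forall a b, e * g a b = w a * x b - w b * x a.
  move=> ->; exists (fun a => \sum_c h c * g a c) => a b.
  rewrite !mulr_suml -sumrB; apply: eq_bigr => c _.
  transitivity (h c * (g a b * x c)); first by ring.
  have -> : g a b * x c = - (g b c * x a) - g c a * x b.
    by apply/eqP; rewrite -subr_eq0 -[X in _ == X](gx a b c); apply/eqP; ring.
  by rewrite (gN c a); ring.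
have [w1 g1] := hom _ _ e1_in; have [w2 g2] := hom _ _ e2_in.
have [w3 g3] := hom _ _ e3_in.
have cocycle u v w w' : (forall a b, u * g a b = w a * x b - w b * x a) ->
    (forall a b, v * g a b = w' a * x b - w' b * x a) ->
    exists m, forall a, v * w a - u * w' a = m * x a.
  move=> gw gw'; apply: koszul_exact1 => a b; apply/eqP; rewrite -subr_eq0; apply/eqP.
  transitivity (v * (w a * x b - w b * x a) - u * (w' a * x b - w' b * x a)).
    by ring.
  by rewrite -gw -gw'; ring.
have [m12 e12] := cocycle _ _ _ _ g1 g2.
have [m13 e13] := cocycle _ _ _ _ g1 g3.
have [m23 e23] := cocycle _ _ _ _ g2 g3.
have [a0 xa0] := koszul_coordinate.
have [|c [d em]] := @e3_regular m12 (- m23) m13.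
  apply: (mulIf xa0); rewrite mulrDl -!mulrA mulNr -e12 -e13 -e23; ring.
have /fin_all_exists[w ew] a : exists b, w1 a - d * x a = e1 * b.
  apply: (@e2_regular _ (w2 a + c * x a)); apply/eqP; rewrite -subr_eq0; apply/eqP.
  transitivity (e2 * w1 a - e1 * w2 a - (e1 * c + e2 * d) * x a); first by ring.
  by rewrite e12 em subrr.
exists w => a b; apply: (mulfI e1_neq0); rewrite g1 mulrBr !mulrA -!ew; ring.
Qed.

End Koszul.

(** * Homogeneous components and pure powers of the variables *)

Section Homogeneous.
Variables (K : fieldType) (n : nat).
Implicit Types (p q : {mpoly K[n]}).

Lemma pihomogM d e p q : q \is e.-homog ->
  pihomog mdeg (d + e) (p * q) = pihomog mdeg d p * q.
Proof.
move=> qe; elim/mpolyind: p => [|c m p _ _ IHp].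
  by rewrite mul0r !pihomog0 mul0r.
rewrite mulrDl !pihomogD mulrDl IHp; congr (_ + _).
have mh : (c *: 'X_[m] : {mpoly K[n]}) \is (mdeg m).-homog.
  by apply: dhomogZ; rewrite dhomogX /= eqxx.
have [md|md] := eqVneq (mdeg m) d.
  by rewrite !pihomog_dE // -?md //; apply: dhomogM.
rewrite (pihomog_ne0 md mh) mul0r; apply: (@pihomog_ne0 _ _ _ (mdeg m + e)).
  by rewrite eqn_add2r.
exact: dhomogM.
Qed.

Lemma pihomogM_lt d e p q : (d < e)%N -> q \is e.-homog ->
  pihomog mdeg d (p * q) = 0.
Proof.
move=> lt_de qe; elim/mpolyind: p => [|c m p _ _ IHp].
  by rewrite mul0r pihomog0.
rewrite mulrDl pihomogD IHp addr0; apply: (@pihomog_ne0 _ _ _ (mdeg m + e)).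
  by rewrite neq_ltn (leq_trans lt_de) ?leq_addl ?orbT.
by apply: dhomogM => //; apply: dhomogZ; rewrite dhomogX /= eqxx.
Qed.

Lemma mcoeff_mulXn (i : 'I_n) N p (m : 'X_{1..n}) : (m i < N)%N ->
  (p * 'X_i ^+ N)@_m = 0.
Proof.
move=> lt_m; rewrite mpolyXn; apply: memN_msupp_eq0; rewrite (perm_mem (msuppMX _ _)).
apply/negP => /mapP[k _ em]; move: lt_m.
by rewrite em mnmDE mulmnE mnm1E eqxx mul1n ltnNge leq_addr.
Qed.

Lemma powers_span N (S : pred 'I_n) p :
    (forall m : 'X_{1..n}, (forall i, S i -> (m i < N)%N) -> p@_m = 0) ->
  exists h, p = \sum_(i | S i) h i * 'X_i ^+ N.
Proof.
move=> p0; rewrite (mpolyE p); apply: (big_ind (fun q => exists h, q = _)).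
- by exists (fun=> 0); rewrite big1 // => i _; rewrite mul0r.
- move=> _ _ [h ->] [h' ->]; exists (fun i => h i + h' i).
  by rewrite -big_split; apply: eq_bigr => i _; rewrite mulrDl.
move=> m _; have [/forall_inP/p0->|] := boolP [forall (i | S i), (m i < N)%N].
  by exists (fun=> 0); rewrite scale0r big1 // => i _; rewrite mul0r.
case/forall_inPn => i Si; rewrite -leqNgt => le_m.
exists (fun j => if j == i then p@_m *: 'X_[m - U_(i) *+ N] else 0).
rewrite (bigD1 i) //= eqxx big1 ?addr0 => [|j /andP[_ /negPf->]]; last by rewrite mul0r.
rewrite mpolyXn -scalerAl -mpolyXD submK //.
apply/mnm_lepP => j; rewrite mulmnE mnm1E; case: eqVneq => [<-|_]; first by rewrite mul1n.
by rewrite mul0n.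
Qed.

(** The ideal of the powers selected by [S] is spanned by monomials, and multiplying by a power of
    ['X_k] does not touch the exponents that decide membership. Hence pure powers form a regular
    sequence. *)
Lemma powers_regular N (S : pred 'I_n) (k : 'I_n) p h : ~~ S k ->
    'X_k ^+ N * p = \sum_(i | S i) h i * 'X_i ^+ N ->
  exists h', p = \sum_(i | S i) h' i * 'X_i ^+ N.
Proof.
move=> Sk e; apply: powers_span => m mS.
rewrite -(mcoeffMX p (U_(k) *+ N)) -mpolyXn mulrC e raddf_sum big1 //= => i Si.
apply: mcoeff_mulXn; rewrite mnmDE mulmnE mnm1E.
by case: (eqVneq k i) Sk => [->|_ _]; [rewrite Si | rewrite mul0n mS].
Qed.

End Homogeneous.

Section KoszulMpoly.
Variables (K : fieldType) (I : finType) (N n : nat) (x : I -> {mpoly K[3]}).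
Hypothesis x_homog : forall a, x a \is n.-homog.
Hypothesis powers_in : forall i : 'I_3, exists h, 'X_i ^+ N = \sum_a h a * x a.

Lemma koszul_mpoly (g : I -> I -> {mpoly K[3]}) : (forall a b, g a b = - g b a) ->
    (forall a b c, g a b * x c + g b c * x a + g c a * x b = 0) ->
  exists w, forall a b, g a b = w a * x b - w b * x a.
Proof.
pose i0 : 'I_3 := ord0; pose i1 : 'I_3 := lift ord0 ord0; pose i2 : 'I_3 := ord_max.
have [h0 e0] := powers_in i0; have [h1 e1] := powers_in i1.
have [h2 e2] := powers_in i2.
apply: (koszul_exact2 _ _ _ e0 e1 e2) => [|m a e|m a b e].
- by rewrite expf_neq0 // -msize_poly_eq0 msizeX mdeg1.
- have [||h ->] := @powers_regular K 3 N (pred1 i0) i1 m (fun=> a).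
  + by [].
  + by rewrite e big_pred1_eq mulrC.
  + by exists (h i0); rewrite big_pred1_eq mulrC.
- have sum2 (h : 'I_3 -> {mpoly K[3]}) :
    \sum_(i | pred2 i0 i1 i) h i * 'X_i ^+ N = 'X_i0 ^+ N * h i0 + 'X_i1 ^+ N * h i1.
    rewrite (bigD1 i0) //= (bigD1 i1) //= big1 ?addr0; first by rewrite mulrC (mulrC (h i1)).
    by case=> [[|[|[]]]].
  have [||h ->] := @powers_regular K 3 N (pred2 i0 i1) i2 m
      (fun i => if i == i0 then a else b).
  + by [].
  + by rewrite e sum2.
  + by exists (h i0), (h i1); rewrite sum2.
Qed.

Lemma koszul_homog d (g : I -> I -> {mpoly K[3]}) :
    (forall a b, g a b \is (d + n).-homog) -> (forall a b, g a b = - g b a) ->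
    (forall a b c, g a b * x c + g b c * x a + g c a * x b = 0) ->
  exists2 w, forall a, w a \is d.-homog &
    forall a b, g a b = w a * x b - w b * x a.
Proof.
move=> gh gN /(koszul_mpoly gN)[w ew]; exists (fun a => pihomog mdeg d (w a)).
  by move=> a; apply: pihomogP.
by move=> a b; rewrite -[LHS](pihomog_dE (gh a b)) ew pihomogB !pihomogM.
Qed.

(** A homogeneous [w] would have the negative degree [d - n]: the products [w a * x b] have no
    component of degree [d]. *)
Lemma koszul_homog_eq0 d (g : I -> I -> {mpoly K[3]}) : (d < n)%N ->
    (forall a b, g a b \is d.-homog) -> (forall a b, g a b = - g b a) ->
    (forall a b c, g a b * x c + g b c * x a + g c a * x b = 0) ->
  forall a b, g a b = 0.
Proof.
move=> lt_dn gh gN /(koszul_mpoly gN)[w ew] a b.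
by rewrite -(pihomog_dE (gh a b)) ew pihomogB !(pihomogM_lt _ lt_dn) // subrr.
Qed.

End KoszulMpoly.

(** * Moving surfaces *)

Lemma dhomog_bigprod (K : fieldType) n (I : finType) (F : I -> {mpoly K[n]})
    (e : I -> nat) : (forall i, F i \is (e i).-homog) ->
  \prod_i F i \is (\sum_i e i)%N.-homog.
Proof.
move=> Fe; apply: (big_rec2 (fun p d => p \is d.-homog)); first exact: dhomog1.
by move=> i d p _; apply: dhomogM.
Qed.

Lemma mmap_homog_scale (K : fieldType) (S : comNzRingType) n d
    (f : {rmorphism K -> S}) (z : 'I_n -> S) (t : S) (p : {mpoly K[n]}) :
  p \is d.-homog -> mmap f (fun i => t * z i) p = t ^+ d * mmap f z p.
Proof.
move=> pd; rewrite /mmap mulr_sumr; apply: eq_big_seq => m mp.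
rewrite /mmap1 (eq_bigr _ (fun i _ => exprMn_comm _ (mulrC _ _))) big_split /=.
by rewrite -expr_sum -mdegE (dhomog_mf pd mp) mulrCA.
Qed.

Lemma meval_homog_scale (K : fieldType) n d (v : 'I_n -> K) t (p : {mpoly K[n]}) :
  p \is d.-homog -> p.@[fun i => t * v i] = t ^+ d * p.@[v].
Proof. exact: (@mmap_homog_scale _ _ _ _ idfun). Qed.

Lemma meval_homog0 (K : fieldType) n d (v : 'I_n -> K) (p : {mpoly K[n]}) :
  (0 < d)%N -> p \is d.-homog -> (forall i, v i = 0) -> p.@[v] = 0.
Proof.
move=> d0 pd v0; rewrite (meval_eq (v2 := fun i => 0 * v i)) => [|i].
  by rewrite (meval_homog_scale _ _ pd) expr0n gtn_eqF // mul0r.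
by rewrite mul0r.
Qed.

Lemma dhomog_comp (K : fieldType) k n d e (x : k.-tuple {mpoly K[n]}) (f : {mpoly K[k]}) :
  (forall a, tnth x a \is e.-homog) -> f \is d.-homog -> f \mPo x \is (e * d).-homog.
Proof.
move=> xe fd; rewrite comp_mpolyEX big_seq rpred_sum // => m mf.
rewrite dhomogZ // comp_mpolyX -(dhomog_mf fd mf) /= mdegE big_distrr /=.
by apply: dhomog_bigprod => i; apply: dhomogMn.
Qed.

Lemma linear_formE (K : fieldType) n (f : {mpoly K[n]}) : f \is 1.-homog ->
  f = \sum_c f@_U_(c) *: 'X_c.
Proof.
move=> f1; apply/mpolyP => m; rewrite raddf_sum /=.
have [|m1] := eqVneq (mdeg m) 1%N.
  move/eqP/mdeg1P => [c /eqP->]; rewrite (bigD1 c) //= mcoeffZ mcoeffXU eqxx mulr1.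
  by rewrite big1 ?addr0 // => b bc; rewrite mcoeffZ mcoeffXU (negPf bc) mulr0.
rewrite (dhomog_nemf_coeff f1 m1) big1 // => c _; rewrite mcoeffZ mcoeffX.
by case: (U_(c)%MM =P m) m1 => [<-|_ _]; rewrite ?mdeg1 ?eqxx // mulr0.
Qed.

Section Surfaces.
Variable (K : fieldType).
Implicit Types (sigma d : nat).

Definition stu sigma (m : 'X_{1..2 < sigma.+1}) : 'X_{1..3} :=
  Multinom [tuple m ord0; m ord_max; (sigma - (m ord0 + m ord_max))%N].

Lemma mdeg2 (m : 'X_{1..2}) : mdeg m = (m ord0 + m ord_max)%N.
Proof. by rewrite mdegE big_ord_recl big_ord1; congr (_ + m _)%N; apply: val_inj. Qed.

Lemma mdeg_stu sigma (m : 'X_{1..2 < sigma.+1}) : mdeg (stu m) = sigma.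
Proof.
rewrite mdegE !big_ord_recl big_ord0 addn0 !multinomE /tnth /= addnA subnKC //.
by rewrite -mdeg2 -ltnS bmdeg.
Qed.

Lemma stu_inj sigma : injective (@stu sigma).
Proof.
move=> m m' /mnmP e; apply/val_inj/mnmP => i.
have := e ord0; have := e (lift ord0 ord0); rewrite !multinomE /tnth /= => e1 e0.
by have [->|->] : i = ord0 \/ i = ord_max
  by case: i => -[|[|//]] lti; [left | right]; apply: val_inj.
Qed.

Lemma stu_surj sigma (m : 'X_{1..3}) : mdeg m = sigma ->
  exists m' : 'X_{1..2 < sigma.+1}, stu m' = m.
Proof.
rewrite mdegE !big_ord_recl big_ord0 addn0 => e.
set m0 := m ord0 in e; set m1 := m _ in e; set m2 := m _ in e.
have lt_m : (mdeg (Multinom [tuple m0; m1]) < sigma.+1)%N.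
  by rewrite mdeg2 !multinomE /tnth /= ltnS -e addnA leq_addr.
exists (BMultinom lt_m); apply/mnmP; case=> -[|[|[|//]]] lti;
  rewrite !multinomE /tnth /= ?multinomE /tnth /=.
- by congr (m _); apply: val_inj.
- by congr (m _); apply: val_inj.
- by rewrite -e addnA addKn; congr (m _); apply: val_inj.
Qed.

Lemma stu_expand sigma (k : {mpoly K[3]}) : k \is sigma.-homog ->
  k = \sum_(m : 'X_{1..2 < sigma.+1}) k@_(stu m) *: 'X_[stu m].
Proof.
move=> kh; apply/mpolyP => m; rewrite raddf_sum /=.
have [/stu_surj[m' <-]|md] := eqVneq (mdeg m) sigma.
  rewrite (bigD1 m') //= mcoeffZ mcoeffX eqxx mulr1 big1 ?addr0 // => b bm.
  by rewrite mcoeffZ mcoeffX (inj_eq (@stu_inj _)) (negPf bm) mulr0.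
rewrite (dhomog_nemf_coeff kh md) big1 // => m' _; rewrite mcoeffZ mcoeffX.
by case: (stu m' =P m) md => [<-|_ _]; rewrite ?mdeg_stu ?eqxx // mulr0.
Qed.

(** The product of [k] and [f], stored by its coefficients in s, t, u. It is meant for [k]
    homogeneous of degree [sigma]; other monomials of [k] are dropped. *)
Definition tensor sigma d (k : {mpoly K[3]}) (f : dhomog 4 K d) :
  moving_surface K d sigma := [ffun m => k@_(stu m) *: f].

Lemma mulXE d sigma a (A : moving_surface K d sigma) m :
  mpoly_of_dhomog (mulX a A m) = 'X_a * mpoly_of_dhomog (A m).
Proof. by rewrite ffunE. Qed.

Lemma mulX_linear d sigma a : linear (@mulX K d sigma a).
Proof.
move=> c A B; apply/ffunP => m; apply: val_inj.
by rewrite [LHS]mulXE ffunE !ffunE /= mulrDr -scalerAr.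
Qed.

HB.instance Definition _ d sigma a :=
  GRing.isLinear.Build K (moving_surface K d sigma) (moving_surface K d.+1 sigma)
    *:%R (@mulX K d sigma a) (mulX_linear a).

Section Substitute.
Variable x : 4.-tuple {mpoly K[3]}.

Lemma substitute_linear d sigma : linear (@substitute K x d sigma).
Proof.
move=> c A B; rewrite /substitute scaler_sumr -big_split /=.
apply: eq_bigr => m _; rewrite !ffunE /=.
by rewrite linearP mulrDl -scalerAl.
Qed.

HB.instance Definition _ d sigma :=
  GRing.isLinear.Build K (moving_surface K d sigma) {mpoly K[3]} *:%R
    (@substitute K x d sigma) (@substitute_linear d sigma).

Lemma substitute_tensor d sigma (k : {mpoly K[3]}) (f : dhomog 4 K d) :
  k \is sigma.-homog ->
  substitute x (tensor sigma k f) = (mpoly_of_dhomog f \mPo x) * k.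
Proof.
move=> kh; rewrite [in RHS](stu_expand kh) mulr_sumr; apply: eq_bigr => m _.
by rewrite ffunE /= linearZ /= -scalerAl -scalerAr.
Qed.

Lemma substitute_mulX d sigma a (A : moving_surface K d sigma) :
  substitute x (mulX a A) = tnth x a * substitute x A.
Proof.
rewrite /substitute mulr_sumr; apply: eq_bigr => m _.
by rewrite mulXE rmorphM /= comp_mpolyXU -tnth_nth mulrA.
Qed.

Lemma follows_mulX d sigma a (A : moving_surface K d sigma) :
  A \in follows x d sigma -> mulX a A \in follows x d.+1 sigma.
Proof. by rewrite !unfold_in substitute_mulX => /eqP->; rewrite mulr0. Qed.

(** Regroups a moving plane by [X_c], as a vector of four forms in s, t, u; the plane follows the
    surface when this vector is a syzygy of [x]. *)
Definition coefX sigma (A : moving_surface K 1 sigma) (c : 'I_4) : {mpoly K[3]} :=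
  \sum_m (mpoly_of_dhomog (A m))@_U_(c) *: 'X_[stu m].

Lemma coefX_homog sigma (A : moving_surface K 1 sigma) c :
  coefX A c \is sigma.-homog.
Proof.
by rewrite rpred_sum // => m _; rewrite dhomogZ // dhomogX /= mdeg_stu.
Qed.

Lemma coefX_stu sigma (A : moving_surface K 1 sigma) c m :
  (coefX A c)@_(stu m) = (mpoly_of_dhomog (A m))@_U_(c).
Proof.
rewrite raddf_sum (bigD1 m) //= mcoeffZ mcoeffX eqxx mulr1 big1 ?addr0 // => b bm.
by rewrite mcoeffZ mcoeffX (inj_eq (@stu_inj _)) (negPf bm) mulr0.
Qed.

Lemma substitute_plane sigma (A : moving_surface K 1 sigma) :
  substitute x A = \sum_c coefX A c * tnth x c.
Proof.
under [RHS]eq_bigr => c _ do rewrite mulr_suml.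
rewrite exchange_big; apply: eq_bigr => m _ /=.
rewrite (linear_formE (dhomog_is_dhomog (A m))) raddf_sum mulr_suml.
apply: eq_bigr => c _; rewrite /= linearZ /= comp_mpolyXU -tnth_nth.
rewrite -linear_formE; last exact: dhomog_is_dhomog.
by rewrite -!scalerAl mulrC.
Qed.

Lemma substitute_homog n d sigma (A : moving_surface K d sigma) :
  (forall a, tnth x a \is n.-homog) -> substitute x A \is (n * d + sigma).-homog.
Proof.
move=> xn; rewrite rpred_sum // => m _; apply: dhomogM.
  by apply: dhomog_comp => //; apply: dhomog_is_dhomog.
by rewrite dhomogX /= -/(stu m) mdeg_stu.
Qed.

End Substitute.

Lemma plane_eq0 sigma (A : moving_surface K 1 sigma) :
  (forall c, coefX A c = 0) -> A = 0.
Proof.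
move=> A0; apply/ffunP => m; apply: val_inj; rewrite ffunE /=.
rewrite (linear_formE (dhomog_is_dhomog (A m))) big1 // => c _.
by rewrite -coefX_stu A0 mcoeff0 scale0r.
Qed.

End Surfaces.

(** * Counting moving planes and quadrics *)

Section LinearAlgebra.
Variables (K : fieldType) (V : vectType K).

Lemma free_codomP (J : finType) (f : J -> V) :
  reflect (forall c : J -> K, \sum_j c j *: f j = 0 -> forall j, c j = 0)
          (free (codom f)).
Proof.
apply: (iffP (freeP (X := codom_tuple f))) => [fr c e j|fr c e i].
  rewrite -[j]enum_rankK; apply: (fr (fun i => c (enum_val i))).
  rewrite -[RHS]e [RHS](reindex _ (onW_bij _ (enum_val_bij J))) /=.
  by apply: eq_bigr => i _; rewrite nth_codom.
have := fr (fun j => c (enum_rank j)) _ (enum_val i); rewrite enum_valK; apply.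
rewrite -[RHS]e (reindex _ (onW_bij _ (enum_val_bij J))) /=.
by apply: eq_bigr => k _; rewrite enum_valK nth_codom.
Qed.

Lemma span_codomP (J : finType) (f : J -> V) v :
  v \in <<codom f>>%VS -> exists c : J -> K, v = \sum_j c j *: f j.
Proof.
move/(@coord_span _ _ _ (codom_tuple f)) => ->.
exists (fun j => coord (codom_tuple f) (enum_rank j) v).
rewrite [RHS](reindex _ (onW_bij _ (enum_val_bij J))) /=.
by apply: eq_bigr => i _; rewrite enum_valK nth_codom.
Qed.

Lemma codom_tnth n (p : n.-tuple V) : codom (tnth p) = p.
Proof. exact: map_tnth_enum. Qed.

End LinearAlgebra.

Lemma allpairs_codom (I : finType) n (T T' : Type) (f : I -> T -> T') (p : n.-tuple T) :
  [seq f a b | a <- enum I, b <- p] = codom (fun ab : I * 'I_n => f ab.1 (tnth p ab.2)).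
Proof.
rewrite /codom /image_mem.
have -> : enum {: I * 'I_n} = prod_enum I 'I_n by rewrite enumT unlock.
by rewrite /prod_enum map_allpairs -{1}(map_tnth_enum p) allpairs_mapr.
Qed.

Lemma bin_add2_double m : ('C(m + 2, m) * 2 = (m + 2) * m.+1)%N.
Proof.
rewrite -(bin_sub (leq_addr 2 m)) addKn mulnC mul_bin_left bin1.
by rewrite addn2 subn1 mulnC.
Qed.

Lemma dim_moving_surface (K : fieldType) d sigma :
  \dim {: moving_surface K d sigma} = (#|{: 'X_{1..2 < sigma.+1}}| * 'C(d + 3, d))%N.
Proof. by rewrite dimvf. Qed.

Lemma dim_dhomog (K : fieldType) n d : \dim {: dhomog n.+1 K d} = 'C(d + n, d).
Proof. by rewrite dimvf. Qed.

Section Planes.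
Variables (K : fieldType) (n : nat) (x : 4.-tuple {mpoly K[3]}).
Hypothesis n_gt0 : (0 < n)%N.
Hypothesis x_homog : forall a, tnth x a \is n.-homog.

Definition subst_dhomog d sigma (A : moving_surface K d sigma) :
    dhomog 3 K (n * d + sigma) := DHomog (substitute_homog A x_homog).

Fact subst_dhomog_linear d sigma : linear (@subst_dhomog d sigma).
Proof. by move=> c A B; apply: val_inj; rewrite /= linearP. Qed.

HB.instance Definition _ d sigma :=
  GRing.isLinear.Build K (moving_surface K d sigma) (dhomog 3 K (n * d + sigma))
    *:%R (@subst_dhomog d sigma) (@subst_dhomog_linear d sigma).

(** The predicate [follows] as the kernel of a linear map between finite-dimensional spaces, so that
    rank and nullity can be counted. *)
Definition follow_space d sigma : {vspace moving_surface K d sigma} :=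
  lker (linfun (@subst_dhomog d sigma)).

Lemma mem_follow_space d sigma (A : moving_surface K d sigma) :
  (A \in follow_space d sigma) = (A \in follows x d sigma).
Proof. by rewrite memv_ker lfunE /= -val_eqE. Qed.

Lemma dim_follow_space d sigma :
  (\dim (follow_space d sigma) + \dim (limg (linfun (@subst_dhomog d sigma))) =
   #|{: 'X_{1..2 < sigma.+1}}| * 'C(d + 3, d))%N.
Proof.
rewrite -(dim_moving_surface K) -(limg_ker_dim (linfun (@subst_dhomog d sigma)) fullv).
by rewrite capfv.
Qed.

Lemma double_rows : ((n + (n ^ 2 - n)./2) * 2 = n * n.+1)%N.
Proof.
case: n n_gt0 => // m _.
have -> : (m.+1 ^ 2 - m.+1 = m.+1 * m)%N by rewrite -mulnn -{3}[m.+1]muln1 -mulnBr subn1.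
have := odd_double_half (m.+1 * m); have -> : odd (m.+1 * m) = false.
  by rewrite oddM /= andNb.
by move: (half _) => t; rewrite -muln2; nia.
Qed.

Lemma subst_onto d sigma N : \dim (follow_space d sigma) = N ->
  (N + 'C(n * d + sigma + 2, n * d + sigma) =
    #|{: 'X_{1..2 < sigma.+1}}| * 'C(d + 3, d))%N ->
  forall h : {mpoly K[3]}, h \is (n * d + sigma).-homog ->
    exists A : moving_surface K d sigma, substitute x A = h.
Proof.
move=> dimN eN h hh; have := dim_follow_space d sigma; rewrite dimN -eN => /addnI eD.
have fullE : limg (linfun (@subst_dhomog d sigma)) = fullv.
  by apply/eqP; rewrite eqEdim subvf dim_dhomog eD leqnn.
have : DHomog hh \in limg (linfun (@subst_dhomog d sigma)) by rewrite fullE memvf.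
case/memv_imgP => A _; rewrite lfunE => /(congr1 val) /= ->.
by exists A.
Qed.

Section ExactlyNPlanes.
Variable p : n.-tuple (moving_surface K 1 n.-1).
Hypothesis p_basis : is_basis (follows x 1 n.-1) p.

(** Rank and nullity: moving planes have dimension [4 n(n+1)/2], the kernel has dimension [n], and
    the difference [n(2n+1)] is the number of monomials of degree [2n-1] in s, t, u. *)
Lemma planes_onto h : h \is (n + n.-1).-homog ->
  exists2 g : 'I_4 -> {mpoly K[3]}, forall a, g a \is n.-1.-homog &
    h = \sum_a g a * tnth x a.
Proof.
have [p_free p_span] := p_basis.
have dimn : \dim (follow_space 1 n.-1) = n.
  rewrite -[RHS](size_tuple p) -(eqP p_free); congr (\dim _).
  by apply/vspaceP => A; rewrite p_span mem_follow_space.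
move=> hh; have [||A eA] := subst_onto dimn _ (h := h); rewrite ?muln1 //.
  rewrite card_rows // bin1; have := double_rows; have := bin_add2_double (n + n.-1).
  by move: (n + (_ - _)./2)%N 'C(_, _) => T C; nia.
by exists (coefX A); [move=> a; apply: coefX_homog | rewrite -eA substitute_plane].
Qed.

(** A monomial of positive degree is a variable times a monomial of one degree less, so surjectivity
    propagates upwards. *)
Lemma planes_onto_add k h : h \is (n + (n.-1 + k)).-homog ->
  exists2 g : 'I_4 -> {mpoly K[3]}, forall a, g a \is (n.-1 + k).-homog &
    h = \sum_a g a * tnth x a.
Proof.
elim: k h => [|k IHk] h; first by rewrite addn0; apply: planes_onto.
move=> hh; rewrite (mpolyE h) big_seq.
apply: (big_ind (fun q => exists2 g : 'I_4 -> {mpoly K[3]},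
   forall a, g a \is (n.-1 + k.+1).-homog & q = \sum_a g a * tnth x a)).
- exists (fun=> 0); first by move=> a; apply: rpred0.
  by rewrite big1 // => a _; rewrite mul0r.
- move=> _ _ [g gh ->] [g' gh' ->]; exists (fun a => g a + g' a).
    by move=> a; apply: rpredD.
  by rewrite -big_split; apply: eq_bigr => a _; rewrite mulrDl.
move=> m mh; have md : mdeg m = (n + (n.-1 + k)).+1.
  by rewrite -!addnS; apply: (dhomog_mf hh mh).
have [i mi] : exists i, (0 < m i)%N.
  apply: contrapT => m0; suff m00 : m = 0%MM by rewrite m00 mdeg0 in md.
  by apply/mnmP => i; rewrite mnm0E; case: (posnP (m i)) => // mi; case: m0; exists i.
have em : m = (U_(i) + (m - U_(i)))%MM by rewrite addmC submK // lep1mP -lt0n.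
have [|g gh eg] := IHk 'X_[m - U_(i)].
  by rewrite dhomogX /=; move: md; rewrite {1}em mdegD mdeg1 add1n => -[->].
exists (fun a => h@_m *: ('X_i * g a)).
  move=> a; rewrite dhomogZ // addnS; apply: (@dhomogM _ _ _ 1%N) => //.
  by rewrite dhomogX /= mdeg1.
have -> : 'X_[m] = 'X_i * 'X_[m - U_(i)] :> {mpoly K[3]} by rewrite {1}em mpolyXD.
rewrite eg mulr_sumr scaler_sumr; apply: eq_bigr => a _.
by rewrite -scalerAl mulrA.
Qed.

(** Write [h] of degree [3n-1] as [\sum_a g_a x_a] with [g_a] of degree [2n-1], then each [g_a] as
    [\sum_b f_ab x_b]; the quadric is [\sum_a \sum_b f_ab X_a X_b]. *)
Lemma quadrics_onto h : h \is (n * 2 + n.-1).-homog ->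
  exists A : moving_surface K 2 n.-1, substitute x A = h.
Proof.
move=> hh; have XX a b : ('X_a * 'X_b : {mpoly K[4]}) \is 2.-homog.
  by apply: (@dhomogM _ _ _ 1%N); rewrite dhomogX /= mdeg1.
have [|g gh ->] := @planes_onto_add n h.
  by move: hh; rewrite muln2 -addnn -addnA (addnC n n.-1).
have /fin_all_exists2[f fh ef] a :
    exists2 f : 'I_4 -> {mpoly K[3]}, forall b, f b \is n.-1.-homog &
      g a = \sum_b f b * tnth x b.
  by apply: planes_onto; rewrite addnC.
exists (\sum_a \sum_b tensor n.-1 (f a b) (DHomog (XX a b))).
rewrite raddf_sum; apply: eq_bigr => a _; rewrite raddf_sum ef mulr_suml.
apply: eq_bigr => b _; rewrite /= substitute_tensor //= rmorphM /= !comp_mpolyXU -!tnth_nth.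
by ring.
Qed.

Lemma dim_quadrics : \dim (follow_space 2 n.-1) = (4 * n + (n ^ 2 - n)./2)%N.
Proof.
have := dim_follow_space 2 n.-1.
have -> : limg (linfun (@subst_dhomog 2 n.-1)) = fullv.
  apply/eqP; rewrite eqEsubv subvf; apply/subvP => h _.
  have [A eA] := quadrics_onto (dhomog_is_dhomog h).
  by apply/memv_imgP; exists A; rewrite ?memvf // lfunE; apply: val_inj; rewrite /= eA.
(* Moving quadrics minus forms of degree [3n-1]: [10 n(n+1)/2 - 3n(3n+1)/2 = 4n + (n^2-n)/2]. *)
rewrite dim_dhomog card_rows //; have := double_rows.
have := bin_add2_double (n * 2 + n.-1); rewrite (_ : 'C(2 + 3, 2) = 10%N) //.
by move: (\dim _) (half _) 'C(_, _) => D T C; nia.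
Qed.

Lemma follows_plane (A : moving_surface K 1 n.-1) : A \in follows x 1 n.-1 ->
  exists c : 'I_n -> K, A = \sum_b c b *: tnth p b.
Proof. by case: p_basis => _ <-; rewrite -{1}(codom_tnth p) => /span_codomP. Qed.

Lemma planes_free (c : 'I_n -> K) : \sum_b c b *: tnth p b = 0 -> forall b, c b = 0.
Proof. by case: p_basis => p_free _; move: c; apply/free_codomP; rewrite codom_tnth. Qed.

Hypothesis no_koszul : forall P : 'I_4 -> moving_surface K 1 n.-1,
  (forall a, P a \in follows x 1 n.-1) -> \sum_a mulX a (P a) = 0 ->
  forall a, P a = 0.

Let multiples : seq (moving_surface K 2 n.-1) :=
  [seq mulX a b | a <- enum 'I_4, b <- p].

Lemma multiples_free : free multiples.
Proof.
rewrite /multiples allpairs_codom; apply/free_codomP => c e.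
(* [P a] collects the planes multiplied by ['X_a], which turns the relation into a linear syzygy
   excluded by [no_koszul]. *)
pose P a := \sum_b c (a, b) *: tnth p b.
have p_follows b : tnth p b \in follows x 1 n.-1.
  by have [_ <-] := p_basis; apply/memv_span/mem_tnth.
have P_follows a : P a \in follows x 1 n.-1.
  rewrite -mem_follow_space rpred_sum // => b _.
  by rewrite rpredZ // mem_follow_space.
have P0 : \sum_a mulX a (P a) = 0.
  rewrite -[RHS]e [RHS](eq_bigr (fun ab => c (ab.1, ab.2) *: mulX ab.1 (tnth p ab.2))).
    rewrite -(pair_bigA _ (fun a b => c (a, b) *: mulX a (tnth p b))) /=.
    by apply: eq_bigr => a _; rewrite raddf_sum; apply: eq_bigr => b _; rewrite /= linearZ.
  by case.
by case=> a b; apply: (planes_free (c := fun b => c (a, b))); apply: no_koszul P0 a.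
Qed.

(** Any basis of a complement of the span of the multiples, inside the following quadrics, can serve
    as [q]; its size comes from [dim_quadrics] and [multiples_free]. *)
Lemma method_applies : exists q : ((n ^ 2 - n)./2).-tuple (moving_surface K 2 n.-1),
  method_choice x p q.
Proof.
pose W := follow_space 2 n.-1; pose U := <<multiples>>%VS.
have UW : (U <= W)%VS.
  apply/span_subvP => _ /allpairsP[[a b] [_ /= bp ->]]; rewrite mem_follow_space.
  apply: follows_mulX; have [_ <-] := p_basis; exact: memv_span.
have dimU : \dim U = (4 * n)%N.
  by rewrite (eqP multiples_free) /multiples size_allpairs size_enum_ord size_tuple.
have dimWU : \dim (W :\: U) = (n ^ 2 - n)./2.
  apply/eqP; rewrite -(eqn_add2l (\dim U)) {2}dimU -dim_quadrics -/W.
  by rewrite -{1}(capv_idPr UW) dimv_cap_compl.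
exists (tcast dimWU (vbasis (W :\: U))); split; first exact: p_basis.
rewrite val_tcast; have /andP[/eqP sp fr] := vbasisP (W :\: U); split.
  rewrite cat_free fr multiples_free sp -/U directv_addE /= !directvE /= ?eqxx /=.
  by rewrite capv_diff eqxx.
by move=> A; rewrite span_cat sp -/U addv_diff (addv_idPl UW) mem_follow_space.
Qed.

End ExactlyNPlanes.
End Planes.

(** * Independence of the multiples of the planes *)

Lemma ord4_ind (P : 'I_4 -> Prop) :
  P 0 -> P 1 -> P (inord 2) -> P (inord 3) -> forall a, P a.
Proof.
move=> P0 P1 P2 P3 [[|[|[|[|//]]]] lt_a].
- by rewrite (_ : Ordinal _ = 0) //; apply: val_inj.
- by rewrite (_ : Ordinal _ = 1) //; apply: val_inj.
- by rewrite (_ : Ordinal _ = inord 2) //; apply: val_inj; rewrite /= inordK.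
- by rewrite (_ : Ordinal _ = inord 3) //; apply: val_inj; rewrite /= inordK.
Qed.

Lemma ord3_ind (P : 'I_3 -> Prop) : P 0 -> P 1 -> P (inord 2) -> forall a, P a.
Proof.
move=> P0 P1 P2 [[|[|[|//]]] lt_a].
- by rewrite (_ : Ordinal _ = 0) //; apply: val_inj.
- by rewrite (_ : Ordinal _ = 1) //; apply: val_inj.
- by rewrite (_ : Ordinal _ = inord 2) //; apply: val_inj; rewrite /= inordK.
Qed.

Lemma sum_ord3 (V : nmodType) (F : 'I_3 -> V) :
  \sum_i F i = F 0 + F 1 + F (inord 2).
Proof.
rewrite !big_ord_recl big_ord0 addr0 addrA; congr (F _ + F _ + F _); apply: val_inj => //.
by rewrite /= inordK.
Qed.

Lemma sum_ord4 (V : nmodType) (F : 'I_4 -> V) :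
  \sum_i F i = F 0 + F 1 + F (inord 2) + F (inord 3).
Proof.
rewrite !big_ord_recl big_ord0 addr0 !addrA.
by congr (F _ + F _ + F _ + F _); apply: val_inj => //; rewrite /= inordK.
Qed.

(* The Hodge dual of [g] in dimension 4. *)
Lemma alternating_dual (A : comNzRingType) (g : 'I_4 -> 'I_4 -> A) (x : 'I_4 -> A) :
    (forall a b, g a b = - g b a) -> (forall a, g a a = 0) ->
    (forall a, \sum_b g a b * x b = 0) ->
  exists g' : 'I_4 -> 'I_4 -> A,
    [/\ forall a b, exists c d, g' a b = g c d,
        forall c d, exists a b, g c d = g' a b,
        forall a b, g' a b = - g' b a &
        forall a b c, g' a b * x c + g' b c * x a + g' c a * x b = 0].
Proof.
move=> gN g0 gx; pose g2 := inord 2 : 'I_4; pose g3 := inord 3 : 'I_4.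
have := gx 0; have := gx 1; have := gx g2; have := gx g3.
rewrite !sum_ord4 -/g2 -/g3 !g0 (gN 1 0) (gN g2 0) (gN g3 0) (gN g2 1) (gN g3 1) (gN g3 g2).
move=> r3 r2 r1 r0.
(* Off the diagonal, [g' a b] is [g c d] with a, b, c, d an even permutation of the four indices.
   The four contractions of [g] with [x] become the cyclic identities for [g']. *)
pose g' (a b : 'I_4) := nth 0 (nth [::] [::
  [:: g 0 0; g g2 g3; g g3 1; g 1 g2]; [:: g g3 g2; g 0 0; g 0 g3; g g2 0];
  [:: g 1 g3; g g3 0; g 0 0; g 0 1]; [:: g g2 1; g 0 g2; g 1 0; g 0 0]] a) b.
have e2 : (g2 : nat) = 2%N by rewrite inordK.
have e3 : (g3 : nat) = 3%N by rewrite inordK.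
exists g'; split.
- apply: ord4_ind; apply: ord4_ind; rewrite -/g2 -/g3 /g' ?e2 ?e3 /=; by do 2 eexists.
- apply: ord4_ind; apply: ord4_ind; rewrite -/g2 -/g3 ?g0.
  + by exists 0, 0; rewrite /g' /= g0.
  + by exists g2, g3; rewrite /g' e2 e3.
  + by exists g3, 1; rewrite /g' e3.
  + by exists 1, g2; rewrite /g' e2.
  + by exists g3, g2; rewrite /g' e2 e3.
  + by exists 0, 0; rewrite /g' /= g0.
  + by exists 0, g3; rewrite /g' e3.
  + by exists g2, 0; rewrite /g' e2.
  + by exists 1, g3; rewrite /g' e3.
  + by exists g3, 0; rewrite /g' e3.
  + by exists 0, 0; rewrite /g' /= g0.
  + by exists 0, 1.
  + by exists g2, 1; rewrite /g' e2.
  + by exists 0, g2; rewrite /g' e2.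
  + by exists 1, 0.
  + by exists 0, 0; rewrite /g' /= g0.
- by apply: ord4_ind; apply: ord4_ind; rewrite -/g2 -/g3 /g' ?e2 ?e3 /= ?g0 ?oppr0.
apply: ord4_ind; apply: ord4_ind; apply: ord4_ind; rewrite -/g2 -/g3 /g' ?e2 ?e3 /=;
  rewrite ?g0 ?(gN 1 0) ?(gN g2 0) ?(gN g3 0) ?(gN g2 1) ?(gN g3 1) ?(gN g3 g2);
  first [ by ring
        | by rewrite -[RHS]r0; ring | by rewrite -[RHS]r1; ring
        | by rewrite -[RHS]r2; ring | by rewrite -[RHS]r3; ring
        | by rewrite -[RHS]oppr0 -[in RHS]r0; ring | by rewrite -[RHS]oppr0 -[in RHS]r1; ring
        | by rewrite -[RHS]oppr0 -[in RHS]r2; ring | by rewrite -[RHS]oppr0 -[in RHS]r3; ring ].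
Qed.

(** In dimension 3 the vector [l] is an alternating form [g], and [l . y = 0] is its cocycle
    identity. So [l] is a cross product of some [w] with [y], and [k] is the matrix of the cross
    product by [w]. *)
Lemma koszul_syzygy (K : fieldType) N n d (y l : 'I_3 -> {mpoly K[3]}) :
    (forall i, y i \is n.-homog) -> (forall i, l i \is (d + n).-homog) ->
    (forall i : 'I_3, exists h, 'X_i ^+ N = \sum_a h a * y a) ->
    \sum_i l i * y i = 0 ->
  exists k : 'I_3 -> 'I_3 -> {mpoly K[3]},
    [/\ forall i j, k i j \is d.-homog, forall i j, k i j = - k j i,
        forall i, k i i = 0 & forall i, l i = \sum_j k i j * y j].
Proof.
move=> yh lh yN ly; pose i2 := inord 2 : 'I_3; have e2 : (i2 : nat) = 2%N by rewrite inordK.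
have := ly; rewrite sum_ord3 -/i2 => {}ly.
pose g (a b : 'I_3) := nth 0 (nth [::] [:: [:: 0; l i2; - l 1];
  [:: - l i2; 0; l 0]; [:: l 1; - l 0; 0]] a) b.
have [|||w wh gw] := @koszul_homog K 'I_3 N n y yh yN d g.
- by apply: ord3_ind; apply: ord3_ind; rewrite -/i2 /g ?e2 /= ?rpredN ?rpred0.
- by apply: ord3_ind; apply: ord3_ind; rewrite -/i2 /g ?e2 /= ?opprK ?oppr0.
- apply: ord3_ind; apply: ord3_ind; apply: ord3_ind; rewrite -/i2 /g ?e2 /=;
    first [ by ring | by rewrite -[RHS]ly; ring
          | by rewrite -[RHS]oppr0 -[in RHS]ly; ring ].
pose k (a b : 'I_3) := nth 0 (nth [::] [:: [:: 0; - w i2; w 1];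
  [:: w i2; 0; - w 0]; [:: - w 1; w 0; 0]] a) b.
have := gw 1 i2; have := gw i2 0; have := gw 0 1; rewrite /g e2 /= => l2 l1 l0.
exists k; split.
- by apply: ord3_ind; apply: ord3_ind; rewrite -/i2 /k ?e2 /= ?rpredN ?rpred0.
- by apply: ord3_ind; apply: ord3_ind; rewrite -/i2 /k ?e2 /= ?opprK ?oppr0.
- by apply: ord3_ind; rewrite -/i2 /k ?e2.
- by apply: ord3_ind; rewrite sum_ord3 -/i2 /k ?e2 /= ?l0 ?l1 ?l2; ring.
Qed.

Section Independence.
Variables (K : fieldType) (n : nat) (x : 4.-tuple {mpoly K[3]}).
Hypothesis n_gt0 : (0 < n)%N.
Hypothesis x_homog : forall a, tnth x a \is n.-homog.

(** All forms of degree [2n-1] lie in the ideal of [x], in particular the pure powers, which supply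
    the regular sequence for Koszul exactness. *)
Lemma powers_in_ideal (p : n.-tuple (moving_surface K 1 n.-1)) :
  is_basis (follows x 1 n.-1) p ->
  forall i : 'I_3, exists h, 'X_i ^+ (n + n.-1) = \sum_a h a * tnth x a.
Proof.
move=> pb i; have [|g _ ->] := planes_onto n_gt0 x_homog pb (h := 'X_i ^+ (n + n.-1)).
  by rewrite mpolyXn dhomogX /= mdegMn mdeg1 mul1n.
by exists g.
Qed.

(** Read off the coefficients of [X_a X_c] and of [X_a^2] in the relation. *)
Lemma linear_syzygy (f : 'I_4 -> dhomog 4 K 1) :
  \sum_a 'X_a * mpoly_of_dhomog (f a) = 0 ->
  forall a c, (mpoly_of_dhomog (f a))@_U_(c) = - (mpoly_of_dhomog (f c))@_U_(a)
    /\ (mpoly_of_dhomog (f a))@_U_(a) = 0.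
Proof.
move=> e; have coef a (g : {mpoly K[4]}) m :
    ('X_a * g)@_(U_(a) + m) = g@_m by rewrite mulrC mcoeffMX.
have coef0 a (g : {mpoly K[4]}) (m : 'X_{1..4}) : m a = 0%N -> ('X_a * g)@_m = 0.
  by move=> ma; rewrite mulrC -['X_a]expr1; apply: mcoeff_mulXn; rewrite ma.
have diag a : (mpoly_of_dhomog (f a))@_U_(a) = 0.
  have := congr1 (mcoeff (U_(a) + U_(a))) e; rewrite raddf_sum mcoeff0 (bigD1 a) //= coef //.
  by rewrite big1 ?addr0 // => b /negPf ba; apply: coef0; rewrite mnmDE !mnm1E eq_sym ba.
move=> a c; split; last exact: diag.
have [<-|ac] := eqVneq a c; first by rewrite diag oppr0.
have := congr1 (mcoeff (U_(a) + U_(c))) e; rewrite raddf_sum mcoeff0 (bigD1 a) //= coef //.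
rewrite (bigD1 c) 1?eq_sym //= [in X in _ + (X + _)]addmC coef //.
rewrite big1 ?addr0 => [/eqP|b /andP[/negPf ba /negPf bc]]; first by rewrite addr_eq0 => /eqP.
by apply: coef0; rewrite mnmDE !mnm1E eq_sym ba eq_sym bc.
Qed.

Lemma no_linear_syzygy (p : n.-tuple (moving_surface K 1 n.-1)) :
  is_basis (follows x 1 n.-1) p ->
  forall P : 'I_4 -> moving_surface K 1 n.-1,
  (forall a, P a \in follows x 1 n.-1) -> \sum_a mulX a (P a) = 0 ->
  forall a, P a = 0.
Proof.
move=> pb P Pf P0 a.
have P0m m : \sum_a 'X_a * mpoly_of_dhomog (P a m) = 0.
  transitivity (mpoly_of_dhomog ((\sum_a mulX a (P a)) m)); last by rewrite P0 ffunE.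
  rewrite sum_ffunE raddf_sum; apply: eq_bigr => b _; exact/esym/mulXE.
pose g a c := coefX (P a) c.
have gN c d : g c d = - g d c.
  rewrite /g /coefX -sumrN; apply: eq_bigr => m _.
  by rewrite (linear_syzygy (P0m m) c d).1 scaleNr.
have g0 c : g c c = 0.
  by rewrite /g /coefX big1 // => m _; rewrite (linear_syzygy (P0m m) c c).2 scale0r.
have gx c : \sum_d g c d * tnth x d = 0.
  by rewrite -substitute_plane; apply/eqP/Pf.
(* The entries of the dual have degree [n-1], below the degree [n] of the coordinates, so
   [koszul_homog_eq0] kills the dual and with it [g]. *)
have [g' [gg' g'g g'N g'x]] := alternating_dual gN g0 gx.
apply: plane_eq0 => c; have [d [e ec]] := g'g a c; rewrite -/(g a c) ec.
apply: (koszul_homog_eq0 x_homog (powers_in_ideal pb) (d := n.-1)) => // [|d' e'].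
  by rewrite prednK.
by have [b [b' ->]] := gg' d' e'; apply: coefX_homog.
Qed.

End Independence.

(** * Quadrics through a point off the surface *)

Section Ideal.
Variables (A : comNzRingType) (J : finType) (y : J -> A).

Definition in_ideal (a : A) := exists h, a = \sum_j h j * y j.

Lemma in_ideal0 : in_ideal 0.
Proof. by exists (fun=> 0); rewrite big1 // => j _; rewrite mul0r. Qed.

Lemma in_idealD a b : in_ideal a -> in_ideal b -> in_ideal (a + b).
Proof.
move=> [h ->] [h' ->]; exists (fun j => h j + h' j).
by rewrite -big_split; apply: eq_bigr => j _; rewrite mulrDl.
Qed.

Lemma in_idealM a b : in_ideal b -> in_ideal (a * b).
Proof.
move=> [h ->]; exists (fun j => a * h j).
by rewrite mulr_sumr; apply: eq_bigr => j _; rewrite mulrA.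
Qed.

Lemma in_ideal_gen j : in_ideal (y j).
Proof.
exists (fun i => (i == j)%:R); rewrite (bigD1 j) //= eqxx mul1r big1 ?addr0 //.
by move=> i /negPf->; rewrite mul0r.
Qed.

Lemma in_ideal_sum (I : finType) (F : I -> A) :
  (forall i, in_ideal (F i)) -> in_ideal (\sum_i F i).
Proof.
by move=> FJ; apply: big_ind => //; [exact: in_ideal0 | exact: in_idealD].
Qed.

Lemma in_ideal_congM a b c d :
  in_ideal (a - b) -> in_ideal (c - d) -> in_ideal (a * c - b * d).
Proof.
move=> ab cd; have -> : a * c - b * d = c * (a - b) + b * (c - d) by ring.
by apply: in_idealD; apply: in_idealM.
Qed.

Lemma in_ideal_congX a b k : in_ideal (a - b) -> in_ideal (a ^+ k - b ^+ k).
Proof. by move=> ab; rewrite subrXX mulrC; apply: in_idealM. Qed.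

Lemma in_ideal_mmap (K : fieldType) n (f : {rmorphism K -> A}) (z z' : 'I_n -> A)
    (p : {mpoly K[n]}) : (forall i, in_ideal (z i - z' i)) ->
  in_ideal (mmap f z p - mmap f z' p).
Proof.
move=> zz'; rewrite /mmap -sumrB; apply: (big_ind in_ideal) => [||m _].
- exact: in_ideal0.
- exact: in_idealD.
rewrite -mulrBr; apply: in_idealM; rewrite /mmap1.
apply: (big_ind2 (fun a b => in_ideal (a - b))) => [||i _].
- by rewrite subrr; apply: in_ideal0.
- by move=> *; apply: in_ideal_congM.
- exact: in_ideal_congX.
Qed.

End Ideal.

Lemma mmap_meval (K : fieldType) m n (v : 'I_n -> K) (p : {mpoly K[n]}) :
  mmap (@mpolyC m K) (fun a => (v a)%:MP) p = p.@[v]%:MP.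
Proof.
rewrite /meval /mmap rmorph_sum; apply: eq_bigr => k _ /=.
rewrite rmorphM /= /mmap1 rmorph_prod; congr (_ * _).
by apply: eq_bigr => i _; rewrite rmorphXn.
Qed.

Section Point.
Variables (K : fieldType) (v : 'I_4 -> K) (a0 : 'I_4).
Hypothesis v_a0 : v a0 != 0.

(* Coordinates of the projection from the point [v] of P^3. *)
Definition proj_from m (z : 'I_4 -> {mpoly K[m]}) (i : 'I_3) : {mpoly K[m]} :=
  v a0 *: z (lift a0 i) - v (lift a0 i) *: z a0.

Lemma proj_from_cong m (z : 'I_4 -> {mpoly K[m]}) a :
  in_ideal (proj_from z) ((v a0)%:MP * z a - z a0 * (v a)%:MP).
Proof.
case: (unliftP a0 a) => [i ->|->]; last by rewrite mulrC subrr; apply: in_ideal0.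
by rewrite mul_mpolyC mulrC mul_mpolyC; apply: in_ideal_gen.
Qed.

(** Modulo the projected coordinates, [v a0 *: z] is congruent to [z a0] times [v]; apply the form
    [F] of degree [d] to both sides. *)
Lemma proj_from_form m d (z : 'I_4 -> {mpoly K[m]}) (F : {mpoly K[4]}) :
  F \is d.-homog ->
  in_ideal (proj_from z)
    ((v a0 ^+ d) *: mmap (@mpolyC m K) z F - F.@[v] *: z a0 ^+ d).
Proof.
move=> Fd; have := in_ideal_mmap (@mpolyC m K) F (proj_from_cong z).
rewrite !(mmap_homog_scale _ _ _ Fd) mmap_meval -rmorphXn /=.
by rewrite mul_mpolyC [in X in _ - X]mulrC mul_mpolyC.
Qed.

(** Since [F] vanishes at [z] but not at [v], [proj_from_form] puts [z a0 ^+ d] in the ideal. Modulo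
    the ideal ['X_i ^+ N] is a multiple of [z a0], so its [d]-th power lies in it. *)
Lemma powers_in_proj N d (z : 'I_4 -> {mpoly K[3]}) (F : {mpoly K[4]}) :
    F \is d.-homog -> mmap (@mpolyC 3 K) z F = 0 -> F.@[v] != 0 ->
    (forall i : 'I_3, exists h, 'X_i ^+ N = \sum_a h a * z a) ->
  forall i : 'I_3, in_ideal (proj_from z) ('X_i ^+ (N * d)).
Proof.
move=> Fd Fz Fv zN i; have [h eh] := zN i.
have zd : in_ideal (proj_from z) (z a0 ^+ d).
  have := in_idealM (- (F.@[v]^-1)%:MP) (proj_from_form z Fd).
  by rewrite Fz scaler0 sub0r mulrNN mul_mpolyC scalerA mulVf // scale1r.
pose t := \sum_a h a * (v a)%:MP.
have Xt : in_ideal (proj_from z) ((v a0)%:MP * 'X_i ^+ N - t * z a0).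
  rewrite eh mulr_sumr mulr_suml -sumrB; apply: in_ideal_sum => a.
  rewrite mulrCA -mulrA -mulrBr; apply: in_idealM.
  by rewrite [_%:MP * z a0]mulrC; apply: proj_from_cong.
have := in_ideal_congX d Xt; rewrite !exprMn -exprM => Xd.
have -> : 'X_i ^+ (N * d) = ((v a0)^-1 ^+ d)%:MP *
    (((v a0)%:MP ^+ d * 'X_i ^+ (N * d) - t ^+ d * z a0 ^+ d) + t ^+ d * z a0 ^+ d)
    :> {mpoly K[3]}.
  rewrite subrK mulrA -rmorphXn -mpolyCM -exprMn mulVf // expr1n mpolyC1.
  by rewrite mul1r.
by apply/in_idealM/in_idealD => //; apply: in_idealM.
Qed.

Lemma proj_formP (i : 'I_3) : proj_from (fun a => 'X_a : {mpoly K[4]}) i \is 1.-homog.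
Proof. by rewrite rpredB // dhomogZ // dhomogX /= mdeg1. Qed.

Definition proj_form (i : 'I_3) : dhomog 4 K 1 := DHomog (proj_formP i).

(** This is [proj_from_form] with the variables themselves for [z]: the term in [f.@[v]] disappears.
    Only the degree 1 parts of the cofactors are kept. *)
Lemma quadric_through (f : dhomog 4 K 2) : (mpoly_of_dhomog f).@[v] = 0 ->
  exists L : 'I_3 -> dhomog 4 K 1, mpoly_of_dhomog f =
    \sum_i mpoly_of_dhomog (proj_form i) * mpoly_of_dhomog (L i).
Proof.
move=> fv; have fh : mpoly_of_dhomog f \is 2.-homog by apply: dhomog_is_dhomog.
have [h] := proj_from_form (fun a => 'X_a : {mpoly K[4]}) fh.
have -> : mmap (@mpolyC 4 K) (fun a => 'X_a) (mpoly_of_dhomog f) = mpoly_of_dhomog f.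
  rewrite -[RHS]comp_mpoly_id /comp_mpoly /mmap; apply: eq_bigr => m _.
  by congr (_ * _); apply: mmap1_eq => i; rewrite tnth_mktuple.
rewrite fv scale0r subr0 => eh.
exists (fun i => (v a0 ^+ 2)^-1 *: DHomog (pihomogP mdeg 1 (h i))).
have := congr1 (pihomog mdeg 2) eh.
rewrite linearZ /= pihomog_dE // => /(congr1 (fun p => (v a0 ^+ 2)^-1 *: p)).
rewrite scalerA mulVf ?expf_neq0 // scale1r => ->.
rewrite (raddf_sum (pihomog mdeg 2)) scaler_sumr; apply: eq_bigr => i _ /=.
by rewrite (pihomogM 1 (h i) (proj_formP i)) -scalerAr mulrC.
Qed.

End Point.

(** * The determinant at a point where the implicit equation does not vanish *)

Section Determinant.
Variables (K : fieldType) (n : nat) (x : 4.-tuple {mpoly K[3]}).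
Hypothesis n_gt0 : (0 < n)%N.
Hypothesis x_homog : forall a, tnth x a \is n.-homog.
Variables (d : nat) (F : {mpoly K[4]}) (v : 'I_4 -> K).
Hypothesis F_homog : F \is d.-homog.
Hypothesis F_x : F \mPo x = 0.
Hypothesis F_v : F.@[v] != 0.
Variable a0 : 'I_4.
Hypothesis v_a0 : v a0 != 0.

Let y := proj_from v a0 (tnth x).

Lemma comp_proj_form i : mpoly_of_dhomog (proj_form v a0 i) \mPo x = y i.
Proof. by rewrite /= raddfB /= !linearZ /= !comp_mpolyXU -!tnth_nth scalerN. Qed.

Variables (p : n.-tuple (moving_surface K 1 n.-1)).
Hypothesis p_basis : is_basis (follows x 1 n.-1) p.

(* A moving quadric vanishing at [X = v] is [sum_i Y_i L_i] with [Y_i] the linear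
   forms vanishing at [v]; the syzygy [sum_i y_i L_i(x) = 0] is a Koszul one, so
   the [L_i] can be corrected to follow the surface. *)
Lemma quadric_through_follows (Q : moving_surface K 2 n.-1) :
    Q \in follows x 2 n.-1 -> (forall m, (mpoly_of_dhomog (Q m)).@[v] = 0) ->
  exists P : 'I_4 -> moving_surface K 1 n.-1,
    [/\ forall a, P a \in follows x 1 n.-1, Q = \sum_a mulX a (P a)
      & \sum_a v a *: P a = 0].
Proof.
move=> Qf Qv; have /fin_all_exists[L eL] m := quadric_through v_a0 (Qv m).
pose A i : moving_surface K 1 n.-1 := [ffun m => L m i].
pose l i := substitute x (A i).
have yl : \sum_i l i * y i = 0.
  rewrite -[RHS](eqP Qf) /substitute.
  under eq_bigr => i _ do rewrite /l /substitute mulr_suml.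
  rewrite exchange_big; apply: eq_bigr => m _ /=.
  rewrite eL raddf_sum mulr_suml; apply: eq_bigr => i _ /=.
  by rewrite ffunE rmorphM /= comp_proj_form; ring.
have yh i : y i \is n.-homog by rewrite rpredB // dhomogZ.
have lh i : l i \is (n.-1 + n).-homog.
  by have := substitute_homog (A i) x_homog; rewrite muln1 addnC.
have yN := powers_in_proj v_a0 F_homog F_x F_v (powers_in_ideal n_gt0 x_homog p_basis).
have [k [kh kN k0 ek]] := koszul_syzygy yh lh yN yl.
(* The correction cancels [l i] after substitution, so [B i] follows; as [k] is alternating, the
   terms [k i j * Y i * Y j] sum to zero and [Q] is unchanged. *)
pose B i := A i - \sum_j tensor n.-1 (k i j) (proj_form v a0 j).
have Bf i : B i \in follows x 1 n.-1.
  rewrite unfold_in /B raddfB /= -/(l i) ek (raddf_sum (@substitute K x 1 n.-1)).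
  rewrite -sumrB big1 //= => j _.
  by rewrite substitute_tensor // comp_proj_form mulrC subrr.
have QB m : mpoly_of_dhomog (Q m) =
    \sum_i mpoly_of_dhomog (proj_form v a0 i) * mpoly_of_dhomog (B i m).
  rewrite eL; set Y := fun i => mpoly_of_dhomog (proj_form v a0 i).
  have BE i : mpoly_of_dhomog (B i m) =
      mpoly_of_dhomog (L m i) - \sum_j (k i j)@_(stu m) *: Y j.
    rewrite !ffunE raddfB /= sum_ffunE raddf_sum /=; congr (_ - _).
    by apply: eq_bigr => j _; rewrite ffunE.
  under [RHS]eq_bigr => i _ do rewrite BE mulrBr.
  rewrite sumrB -[LHS]subr0; congr (_ - _); apply/esym.
  have kNm i j : (k i j)@_(stu m) = - (k j i)@_(stu m) by rewrite {1}kN mcoeffN.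
  have k0m i : (k i i)@_(stu m) = 0 by rewrite k0 mcoeff0.
  rewrite sum_ord3 !sum_ord3 !k0m (kNm 1 0) (kNm (inord 2) 0) (kNm (inord 2) 1).
  by rewrite -!mul_mpolyC !mpolyCN mpolyC0 -/(Y 0) -/(Y 1) -/(Y (inord 2)); ring.
have BF i : B i \in follow_space x_homog 1 n.-1 by rewrite mem_follow_space.
(* Expand each [Y i] as [v a0 *: 'X_(lift a0 i) - v (lift a0 i) *: 'X_a0] and collect by variable;
   the cancellation in [\sum_a v a *: P a] reflects that every [Y i] vanishes at [v]. *)
pose P a := if unlift a0 a is Some i then v a0 *: B i
  else - \sum_i v (lift a0 i) *: B i.
have Pa0 : P a0 = - \sum_i v (lift a0 i) *: B i by rewrite /P unlift_none.
have Pl i : P (lift a0 i) = v a0 *: B i by rewrite /P liftK.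
exists P; split.
- move=> a; rewrite -(mem_follow_space x_homog) /P; case: unlift => [i|].
    by rewrite rpredZ.
  by rewrite rpredN rpred_sum // => i _; rewrite rpredZ.
- apply/ffunP => m; apply: val_inj; rewrite /= QB sum_ffunE raddf_sum /=.
  rewrite (bigD1_ord a0) //= mulXE Pa0 !ffunE sum_ffunE raddfN raddf_sum /=.
  rewrite mulrN mulr_sumr -sumrN -big_split /=; apply: eq_bigr => i _.
  rewrite mulXE Pl !ffunE /= mulrBl -!scalerAl -!scalerAr.
  by rewrite addrC.
rewrite (bigD1_ord a0) //= Pa0 scalerN scaler_sumr -sumrN -big_split big1 //= => i _.
by rewrite Pl !scalerA mulrC addNr.
Qed.

Variable q : ((n ^ 2 - n)./2).-tuple (moving_surface K 2 n.-1).
Hypothesis pq_choice : method_choice x p q.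

Lemma method_matrix_eval i (w : 'rV[K]_(n + (n ^ 2 - n)./2)) :
  \sum_j w 0 j * (method_matrix n_gt0 p q i j).@[v] =
  let m := enum_val (cast_ord (esym (card_rows n_gt0)) i) in
  \sum_b w 0 (lshift _ b) * (mpoly_of_dhomog (tnth p b m)).@[v] +
  \sum_c w 0 (rshift _ c) * (mpoly_of_dhomog (tnth q c m)).@[v].
Proof.
rewrite big_split_ord /=; congr (_ + _); apply: eq_bigr => j _.
  by rewrite /method_matrix row_mxEl mxE.
by rewrite /method_matrix row_mxEr mxE.
Qed.

Theorem det_method_neq0 : (\det (method_matrix n_gt0 p q)).@[v] != 0.
Proof.
rewrite -det_map_mx -det_tr; apply/det0P => -[w w0 ew].
pose al b := w 0 (lshift _ b); pose be c := w 0 (rshift _ c).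
(* Multiplying a plane by ['X_a0] and dividing by [v a0] makes it a quadric with the same value at
   [v]; hence the column relation [w] says that [Q] vanishes at [v]. *)
pose Q := mulX a0 (\sum_b ((v a0)^-1 * al b) *: tnth p b) + \sum_c be c *: tnth q c.
have [_ [qm_free qm_span]] := pq_choice.
have pf b : tnth p b \in follow_space x_homog 1 n.-1.
  by rewrite mem_follow_space; have [_ <-] := p_basis; apply/memv_span/mem_tnth.
have qf c : tnth q c \in follow_space x_homog 2 n.-1.
  rewrite mem_follow_space; have [_ [_ <-]] := pq_choice.
  by apply: memv_span; rewrite mem_cat mem_tnth.
have Qf : Q \in follows x 2 n.-1.
  rewrite -(mem_follow_space x_homog) rpredD //.
    rewrite mem_follow_space follows_mulX // -(mem_follow_space x_homog).
    by rewrite rpred_sum // => b _; rewrite rpredZ.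
  by rewrite rpred_sum // => c _; rewrite rpredZ.
have Qv m : (mpoly_of_dhomog (Q m)).@[v] = 0.
  pose i := cast_ord (card_rows n_gt0) (enum_rank m).
  have := congr1 (fun u : 'rV_ _ => u 0 i) ew; rewrite !mxE.
  under eq_bigr => j _ do rewrite 2!mxE.
  rewrite method_matrix_eval /= cast_ordK enum_rankK => <-.
  rewrite /Q ffunE raddfD /= mulXE mevalM mevalXU; congr (_ + _).
    rewrite sum_ffunE !raddf_sum mulr_sumr; apply: eq_bigr => b _ /=.
    by rewrite ffunE /= mevalZ mulrA mulrA mulfV // mul1r.
  by rewrite sum_ffunE !raddf_sum; apply: eq_bigr => c _ /=; rewrite ffunE /= mevalZ.
have [P [Pf QP Pv]] := quadric_through_follows Qf Qv.
have /fin_all_exists[pi ePi] a := follows_plane p_basis (Pf a).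
(* Coordinates, on the products of a variable and a plane, of [\sum_a mulX a (P a)] minus the plane
   part of [Q]. What remains is the quadric part, so independence makes both [u] and [be] vanish. *)
pose u ab : K := pi ab.1 ab.2 - (ab.1 == a0)%:R * ((v a0)^-1 * al ab.2).
have sumu : \sum_ab u ab *: mulX ab.1 (tnth p ab.2) = \sum_c be c *: tnth q c.
  have -> : \sum_c be c *: tnth q c = Q -
      mulX a0 (\sum_b ((v a0)^-1 * al b) *: tnth p b) by rewrite addrC addKr.
  rewrite QP; under eq_bigr => ab _ do rewrite scalerBl.
  rewrite sumrB; congr (_ - _).
    rewrite -(pair_bigA _ (fun a b => pi a b *: mulX a (tnth p b))) /=.
    apply: eq_bigr => a _; rewrite ePi raddf_sum; apply: eq_bigr => b _.
    by rewrite /= linearZ.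
  rewrite -(pair_bigA _ (fun a b =>
    ((a == a0)%:R * ((v a0)^-1 * al b)) *: mulX a (tnth p b))) /=.
  rewrite (bigD1 a0) //= [X in _ + X]big1 ?addr0 => [|a /negPf->]; last first.
    by rewrite big1 // => b _; rewrite mul0r scale0r.
  rewrite raddf_sum; apply: eq_bigr => b _.
  by rewrite /= eqxx mul1r linearZ.
move: qm_free; rewrite cat_free => /and3P[q_free m_free /directv_addP qm0].
have be_sum0 : \sum_c be c *: tnth q c = 0.
  apply/eqP; rewrite -memv0 -qm0 memv_cap; apply/andP; split.
    by rewrite rpred_sum // => c _; rewrite rpredZ // memv_span // mem_tnth.
  rewrite -sumu allpairs_codom rpred_sum // => ab _; rewrite rpredZ // memv_span //.
  exact: codom_f (fun ab => mulX ab.1 (tnth p ab.2)) ab.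
have be0 c : be c = 0.
  by move: c; apply: (elimT (free_codomP _)) be_sum0; rewrite codom_tnth.
have u0 ab : u ab = 0.
  rewrite be_sum0 in sumu; move: ab; apply: (elimT (free_codomP _)) sumu.
  by rewrite -allpairs_codom.
have P0 a : a != a0 -> P a = 0.
  move=> /negPf aa0; rewrite ePi big1 // => b _.
  by have /eqP := u0 (a, b); rewrite /u /= aa0 mul0r subr0 => /eqP->; rewrite scale0r.
(* With the other [P a] gone, the relation [\sum_a v a *: P a = 0] leaves [v a0 *: P a0 = 0]. *)
have Pa0 : P a0 = 0.
  move: Pv; rewrite (bigD1 a0) //= big1 => [|a /P0->]; last by rewrite scaler0.
  by rewrite addr0 => /eqP; rewrite scaler_eq0 (negPf v_a0) => /eqP.
have al0 b : al b = 0.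
  have pi0 : pi a0 b = 0 by apply: (planes_free p_basis); rewrite -ePi.
  have /eqP := u0 (a0, b); rewrite /u /= eqxx mul1r pi0 sub0r oppr_eq0 mulf_eq0.
  by rewrite invr_eq0 (negPf v_a0) => /eqP.
case/eqP: w0; apply/rowP => j; rewrite mxE -(splitK j).
by case: split => i /=; [apply: al0 | apply: be0].
Qed.

End Determinant.

(** * The determinant as a power of the implicit equation *)

Section ImplicitEquation.
Variables (K : closedFieldType) (n : nat) (x : 4.-tuple {mpoly K[3]}).
Hypothesis n_gt0 : (0 < n)%N.
Hypothesis x_homog : forall a, tnth x a \is n.-homog.

(** It suffices to evaluate at every parameter. If some coordinate is nonzero there, the parameter
    is nonzero because [n > 0] and gives a point of the image; otherwise [F], of positive degree,
    vanishes at the zero vector. *)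
Lemma implicit_equation_comp (F : {mpoly K[4]}) :
  implicit_equation x F -> F \mPo x = 0.
Proof.
move=> [[F0 [d d0 Fd]] _ Fx _]; apply: mpoly_fun_eq0 => pt.
rewrite comp_mpoly_meval.
have [|x0] := EM (exists a, (tnth x a).@[pt] != 0).
  case=> a xa; apply: Fx; split; first by exists a.
  exists pt => //; apply: contrapT => pt0; case/eqP: xa.
  apply: (meval_homog0 n_gt0 (x_homog a)) => i.
  by apply/eqP; apply: contrapT => /negP pti; case: pt0; exists i.
apply: (meval_homog0 d0 Fd) => a.
by apply/eqP; apply: contrapT => /negP xa; case: x0; exists a.
Qed.

(** The entries are forms of degree 1 or 2, so the matrix vanishes at the origin, and it is not
    empty since [n > 0]. *)
Lemma det_method_at0 (p : n.-tuple (moving_surface K 1 n.-1))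
    (q : ((n ^ 2 - n)./2).-tuple (moving_surface K 2 n.-1)) :
  (\det (method_matrix n_gt0 p q)).@[fun=> 0] = 0.
Proof.
rewrite -det_map_mx; set M := map_mx _ _; have -> : M = 0 *: M.
  rewrite scale0r; apply/matrixP => i j; rewrite [LHS]mxE [RHS]mxE /method_matrix.
  rewrite -(splitK j); case: split => b /=; rewrite ?row_mxEl ?row_mxEr mxE.
    by apply: (@meval_homog0 _ _ 1%N) => //; apply: dhomog_is_dhomog.
  by apply: (@meval_homog0 _ _ 2%N) => //; apply: dhomog_is_dhomog.
by rewrite detZ expr0n addn_eq0 (gtn_eqF n_gt0) mul0r.
Qed.

Theorem det_method_power (F : {mpoly K[4]})
    (p : n.-tuple (moving_surface K 1 n.-1))
    (q : ((n ^ 2 - n)./2).-tuple (moving_surface K 2 n.-1)) :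
  implicit_equation x F -> method_choice x p q ->
  exists (c : K) (k : nat),
    [/\ c != 0, (0 < k)%N & \det (method_matrix n_gt0 p q) = c *: F ^+ k].
Proof.
move=> Fimp pq; have Fx := implicit_equation_comp Fimp.
have [[F0 [d d0 Fd]] [_ _ Firr] _ _] := Fimp.
have detN0 v : F.@[v] != 0 -> (\det (method_matrix n_gt0 p q)).@[v] != 0.
  move=> Fv; have [a0 va0] : exists a0, v a0 != 0.
    apply: contrapT => v0; case/eqP: Fv; apply: (meval_homog0 d0 Fd) => a.
    by apply/eqP; apply: contrapT => /negP va; case: v0; exists a.
  by apply: (det_method_neq0 n_gt0 x_homog Fd Fx Fv va0) => //; case: pq.
have [v Fv] : exists v, F.@[v] != 0.
  apply: contrapT => Fv; case/eqP: F0; apply: mpoly_fun_eq0 => v.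
  by apply/eqP; apply: contrapT => /negP va; case: Fv; exists v.
have det0 : \det (method_matrix n_gt0 p q) != 0.
  by apply: contraNneq (detN0 v Fv) => ->; rewrite meval0.
have [|c [[|k] [c0 ek]]] := zero_locus_power det0 Firr.
- by move=> w /eqP dw; apply/eqP; apply: contraLR dw; apply: detN0.
(* Exponent 0 would make the determinant a nonzero constant, contrary to its vanishing at the
   origin. *)
- have := det_method_at0 p q.
  by rewrite ek expr0 mevalZ meval1 mulr1 => c00; rewrite c00 eqxx in c0.
- by exists c, k.+1; split.
Qed.

End ImplicitEquation.

Theorem corollary5p7 (R : realType) (n : nat) (n_gt0 : (0 < n)%N)
    (x : 4.-tuple {mpoly R[i][3]})
    (x_homog : forall a : 'I_4, tnth x a \is n.-homog)
    (x_nobase : no_base_points x)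
    (dim_planes : exists p : n.-tuple (moving_surface R[i] 1 n.-1),
        is_basis (follows x 1 n.-1) p) :
  (forall p : n.-tuple (moving_surface R[i] 1 n.-1),
      is_basis (follows x 1 n.-1) p ->
      exists q : ((n ^ 2 - n)./2).-tuple (moving_surface R[i] 2 n.-1),
        method_choice x p q) /\
  (forall (F : {mpoly R[i][4]})
      (p : n.-tuple (moving_surface R[i] 1 n.-1))
      (q : ((n ^ 2 - n)./2).-tuple (moving_surface R[i] 2 n.-1)),
      implicit_equation x F -> method_choice x p q ->
      exists (c : R[i]) (k : nat),
        [/\ c != 0, (0 < k)%N & \det (method_matrix n_gt0 p q) = c *: F ^+ k]).
Proof.
split=> [p pb|F p q].
  exact: (method_applies n_gt0 x_homog pb (no_linear_syzygy n_gt0 x_homog pb)).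
exact: det_method_power.
Qed.
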